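(* Let $V$ be a real vector space of finite dimension $n>0$, let $p,p'\ge 0$ be integers with $p+p'=n$, and let $\Gamma$ be the homogeneous space of all scalar products of signature $(p,p')$ on $V$, with the action of $GL(V)$ given by $g\gamma:=(g^{-1})^*\gamma$. Then there exists a non-zero invariant measure on $\Gamma$, and it is unique up to a positive multiplicative constant: if $d\mu$ and $d\mu'$ are two non-zero invariant measures on $\Gamma$, then $d\mu=c\,d\mu'$ for some real number $c>0$.
   Context: A scalar product on $V$ is a non-degenerate symmetric bilinear form $V\times V\to\mathbb{R}$; its signature is $(p,p')$ if in an orthonormal basis $p$ vectors have square $+1$ and $p'$ vectors have square $-1$. The set $\Gamma$ is an open subset of the vector space $\Sigma\cong\mathbb{R}^{n(n+1)/2}$ of all symmetric bilinear forms on $V$, and carries the induced topology and real-analytic manifold structure. The group $GL(V)$ acts (transitively and analytically) on $\Gamma$ by $(g\gamma)(v,v')=\gamma(g^{-1}v,g^{-1}v')$; write $\bar g:\Gamma\to\Gamma$, $\gamma\mapsto g\gamma$. ''Measure'' means a regular Borel measure on a locally compact Hausdorff space. For a homeomorphism $\varphi:Y\to Y'$ of locally compact Hausdorff spaces and a measure $d\mu$ on $Y$, the pushforward $\varphi_\star d\mu$ is the unique regular Borel measure on $Y'$ with $\int_{Y'} f\,(\varphi_\star d\mu)=\int_Y (f\circ\varphi)\,d\mu$ for all continuous compactly supported $f:Y'\to\mathbb{R}$. A measure $d\mu$ on $\Gamma$ is invariant if $\bar g_\star d\mu=d\mu$ for every $g\in GL(V)$. *)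

(* Defs.v *)
From HB Require Import structures.
From mathcomp Require Import all_boot all_order all_algebra.
From mathcomp Require Import all_classical all_reals all_analysis.

Set Implicit Arguments.
Unset Strict Implicit.
Unset Printing Implicit Defensive.

Import Order.TTheory GRing.Theory Num.Theory.
Import numFieldNormedType.Exports.

Local Open Scope classical_set_scope.
Local Open Scope ring_scope.

Definition borelType (T : ptopologicalType) := g_sigma_algebraType (@open T).

Section Measures.
Context {R : realType}.
Local Open Scope ereal_scope.

(* Regular in the sense of Radon measures: finite on compact sets, outer
   regular on Borel sets, inner regular on open sets. *)
Definition regular_measure (T : ptopologicalType)
    (mu : {measure set (borelType T) -> \bar R}) : Prop :=
  [/\ forall K : set T, compact K -> mu K < +oo,
      forall A : set (borelType T), measurable A ->
        mu A = ereal_inf [set mu U | U in [set U : set T | open U /\ A `<=` U]]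
    & forall U : set T, open U ->
        mu U =
        ereal_sup [set mu K | K in [set K : set T | compact K /\ K `<=` U]]].

Definition compactly_supported (T : topologicalType) (f : T -> R) : Prop :=
  compact (closure [set x | f x != 0%R]).

(* For phi a homeomorphism of locally compact Hausdorff spaces and mu regular,
   exactly one nu satisfies this (Riesz representation): it is phi_* mu, so the
   equation "phi_* mu = nu" is rendered by this relation. *)
Definition is_pushforward (Y Y' : ptopologicalType) (phi : Y -> Y')
    (mu : {measure set (borelType Y) -> \bar R})
    (nu : {measure set (borelType Y') -> \bar R}) : Prop :=
  regular_measure nu /\
  forall f : Y' -> R, continuous f -> compactly_supported f ->
    \int[nu]_y (f y)%:E = \int[mu]_x (f (phi x))%:E.

(* Stated on Borel sets only, since a {measure set T -> \bar R} also takes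
   (meaningless) values on non-measurable sets. *)
Definition nonzero_measure (T : ptopologicalType)
    (mu : {measure set (borelType T) -> \bar R}) : Prop :=
  exists2 A : set (borelType T), measurable A & mu A != 0.

End Measures.

Section Forms.
Context {R : realType} (V : vectType R).

Definition symmetric_forms : set (V -> V -> R) :=
  [set b | [/\ forall v, scalar (b v), forall v', scalar (b ^~ v')
             & forall v v', b v v' = b v' v]].

Definition Sigma : Type := set_type symmetric_forms.

Definition form_val (b : Sigma) : V -> V -> R := set_val b.
Coercion form_val : Sigma >-> Funclass.

Definition gram_matrix (b : Sigma) : 'M[R]_(\dim {:V}) :=
  \matrix_(i, j) b (vbasis {:V})`_i (vbasis {:V})`_j.

HB.instance Definition _ := Choice.on Sigma.

(* gram_matrix is a linear isomorphism onto the symmetric matrices, so this is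
   the topology of Sigma as a finite-dimensional real vector space. *)
HB.instance Definition _ := Topological.copy Sigma (initial_topology gram_matrix).

Definition nondegenerate_form (b : Sigma) : Prop :=
  forall v, (forall v', b v v' = 0) -> v = 0.

Definition orthonormal_basis (b : Sigma) (e : (\dim {:V}).-tuple V) : Prop :=
  [/\ basis_of {:V} e,
      forall i j : 'I_(\dim {:V}), i != j -> b e`_i e`_j = 0
    & forall i : 'I_(\dim {:V}), b e`_i e`_i = 1 \/ b e`_i e`_i = -1].

Definition has_signature (p p' : nat) (b : Sigma) : Prop :=
  exists e : (\dim {:V}).-tuple V,
  [/\ orthonormal_basis b e,
      #|[set i : 'I_(\dim {:V}) | b e`_i e`_i == 1]%SET| = p
    & #|[set i : 'I_(\dim {:V}) | b e`_i e`_i == -1]%SET| = p'].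

Definition scalar_products (p p' : nat) : set Sigma :=
  [set b | nondegenerate_form b /\ has_signature p p' b].

Definition GL : set 'End(V) := [set g | bijective g].

Lemma GL_lker (g : GL) : lker (val g) == 0%VS.
Proof. by apply/lker0P/bij_inj; have := set_mem (valP g). Qed.

Definition transport (g : GL) (b : V -> V -> R) : V -> V -> R :=
  fun v v' => b ((val g)^-1%VF v) ((val g)^-1%VF v').

Lemma transport_symmetric (g : GL) (b : Sigma) :
  transport g b \in symmetric_forms.
Proof.
have [bl br bs] := set_mem (valP b).
apply/mem_set; split=> [v a x y|v' a x y|v v'] /=; rewrite /transport.
- by rewrite linearP; exact: bl.
- by rewrite linearP; exact: br.
- exact: bs.
Qed.

Definition act_form (g : GL) (b : Sigma) : Sigma :=
  exist _ (transport g b) (transport_symmetric g b).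

Lemma act_form_scalar_product p p' (g : GL) (b : Sigma) :
  scalar_products p p' b -> scalar_products p p' (act_form g b).
Proof.
have gK := lker0_lfunK (GL_lker g).
have gVK := lker0_lfunVK (GL_lker g).
move=> [b_nd [e [[be e_orth e_pm] ep ep']]]; split.
  move=> v vb; have /(congr1 (val g)) : (val g)^-1%VF v = 0.
    by apply: b_nd => w; rewrite -(gK w); exact: (vb (val g w)).
  by rewrite gVK linear0.
pose h : (\dim {:V}).-tuple V := map_tuple (val g) e.
have hE (i j : 'I_(\dim {:V})) : act_form g b h`_i h`_j = b e`_i e`_j.
  rewrite /h /= !(nth_map 0) ?size_tuple //.
  by rewrite [LHS]/(transport g b _ _) /transport !gK.
exists h; split.
- split=> [|i j ij|i]; rewrite ?hE; [|exact: e_orth|exact: e_pm].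
  have : basis_of (limg (val g)) h.
    by apply: limg_basis_of => //; rewrite (eqP (GL_lker g)) capv0.
  by rewrite lker0_limgf ?GL_lker.
- by rewrite -ep; apply: eq_card => i; rewrite !inE hE.
- by rewrite -ep'; apply: eq_card => i; rewrite !inE hE.
Qed.

Section Gamma.
Variables (p p' : nat) (hpp' : (p + p')%N = \dim {:V}).

Let sgn (i : nat) : R := if (i < p)%N then 1 else -1.

Let std (v v' : V) : R := \sum_(i < \dim {:V})
  sgn i * coord (vbasis {:V}) i v * coord (vbasis {:V}) i v'.

Let std_sym : std \in symmetric_forms.
Proof.
apply/mem_set; split=> [v a x y|v' a x y|v v'] /=; rewrite /std.
- rewrite mulr_sumr -big_split /=; apply: eq_bigr => i _.
  by rewrite linearP /= mulrDr mulrCA.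
- rewrite mulr_sumr -big_split /=; apply: eq_bigr => i _.
  by rewrite linearP /= mulrDr mulrDl mulrCA !mulrA.
- by apply: eq_bigr => i _; rewrite mulrAC.
Qed.

Let std_form : Sigma := exist _ std std_sym.

Let std_vbasis (v : V) (j : 'I_(\dim {:V})) :
  std_form v (vbasis {:V})`_j = sgn j * coord (vbasis {:V}) j v.
Proof.
rewrite [LHS]/(std _ _) /std (bigD1 j) //= big1 ?addr0.
  by rewrite coord_free ?(basis_free (vbasisP _)) // eqxx mulr1.
move=> i ij; rewrite coord_free ?(basis_free (vbasisP _)) // eq_sym.
by rewrite (negbTE ij) mulr0.
Qed.

Let std_vbasis2 (i j : 'I_(\dim {:V})) :
  std_form (vbasis {:V})`_i (vbasis {:V})`_j = sgn j * (i == j)%:R.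
Proof.
by rewrite std_vbasis coord_free ?(basis_free (vbasisP _)) // eq_sym.
Qed.

Lemma scalar_products_neq0 : scalar_products p p' !=set0.
Proof.
exists std_form; split.
  move=> v vb; rewrite (coord_vbasis (memvf v)) big1 // => i _.
  have /eqP := vb (vbasis {:V})`_i; rewrite std_vbasis mulf_eq0 /sgn.
  by case: ifP => _; rewrite ?oppr_eq0 oner_eq0 /= => /eqP ->; rewrite scale0r.
have neq1N1 : (1 == -1 :> R) = false.
  by rewrite gt_eqF // (lt_trans (ltrN10 _) ltr01).
have cardp : #|[set i : 'I_(\dim {:V}) | (i < p)%N]%SET| = p.
  by rewrite -hpp' -sum1dep_card big_ord_narrow ?leq_addr // sum1_card card_ord.
exists (vbasis {:V}); split.
- split=> [|i j ij|i]; first exact: vbasisP.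
    by rewrite std_vbasis2 (negbTE ij) mulr0.
  by rewrite std_vbasis2 eqxx mulr1 /sgn; case: ifP; [left|right].
- rewrite -[RHS]cardp; apply: eq_card => i.
  rewrite !inE std_vbasis2 eqxx mulr1 /sgn.
  by case: ifP; rewrite ?eqxx // eq_sym neq1N1.
- have -> : [set i : 'I_(\dim {:V}) |
      std_form (vbasis {:V})`_i (vbasis {:V})`_i == -1]%SET
    = (~: [set i : 'I_(\dim {:V}) | (i < p)%N])%SET.
    apply/setP => i; rewrite !inE std_vbasis2 eqxx mulr1 /sgn.
    by case: ifP; rewrite ?eqxx ?neq1N1.
  by rewrite cardsCs finset.setCK cardp card_ord -hpp' addKn.
Qed.

(* The hypothesis p + p' = dim V is a parameter because the measurable spaces
   of the library are pointed: it makes this type inhabited. The topology is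
   the one induced by Sigma. *)
Definition Gamma of (p + p')%N = \dim {:V} : Type :=
  set_type (scalar_products p p').

Let Gamma_point : Gamma hpp'.
Proof.
have [b sb] := cid scalar_products_neq0.
by exists b; apply/mem_set.
Qed.

HB.instance Definition _ :=
  Topological.copy (Gamma hpp') (set_type (scalar_products p p')).
HB.instance Definition _ := isPointed.Build (Gamma hpp') Gamma_point.

Definition gbar (g : GL) (b : Gamma hpp') : Gamma hpp' :=
  exist _ (act_form g (val b))
    (mem_set (act_form_scalar_product g (set_mem (valP b)))).

Definition invariant_measure
    (mu : {measure set (borelType (Gamma hpp')) -> \bar R}) : Prop :=
  regular_measure mu /\ forall g : GL, is_pushforward (gbar g) mu mu.

End Gamma.
End Forms.

Arguments GL {R} V _ : rename.

(* Main.v *)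
From HB Require Import structures.
Require Import Defs.
From mathcomp Require Import lra.
From mathcomp Require Import all_boot all_order all_algebra perm.
From mathcomp Require finmap.
From mathcomp Require Import all_classical all_reals all_analysis.
From mathcomp Require Import measurable_realfun measurable_fun_approximation.

(* Uniqueness: the density rho of one invariant measure with respect to the sum
   m of the two is invariant, up to m-null sets, under each g in GL(V). By
   Fubini with respect to Lebesgue measure on the matrices g, and because the
   null sets of that measure are preserved by right translations, transitivity
   forces rho to be m-almost everywhere constant.

   Existence: in the coordinates given by the Gram matrix S, the measure is
   |det S|^(-N/n) dS, where N is the dimension of the space of symmetric
   matrices. The map S |-> P S P^T scales Lebesgue measure by a factor chi(P)
   that is multiplicative in P; a transvection is conjugate to its own square,
   so chi is 1 on SL_n, hence chi(P) depends only on |det P| and is computed on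
   scalar matrices. The orbit of a diagonal matrix of signs is open by Schur
   complements, so that this measure is not zero. *)

Set Implicit Arguments.
Unset Strict Implicit.
Unset Printing Implicit Defensive.

Import Order.TTheory GRing.Theory Num.Theory.
Import numFieldNormedType.Exports.

Local Open Scope classical_set_scope.
Local Open Scope ring_scope.

(** * Invariant measures under a transitive family of maps *)

(** The null set on which rho fails to be invariant depends on g, and there are uncountably many g.
    Fubini turns a statement for each g and almost every x into one for almost every x and almost
    every g. Lebesgue measure on the matrices of nonzero determinant can stand for a Haar measure
    because only its null sets enter: a right translation is a linear automorphism, hence multiplies
    Lebesgue measure by a positive constant.

    Invariance is given through integrals of compactly supported functions, so it is first extended
    to Borel sets; conversely, the constructed measure has to be shown regular. Both use that the
    Gram matrix chart has open range.

    The exponent N/n balances two factors. The scalar matrix t acts on symmetric matrices as t^2, so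
    preimages of sets have their measure multiplied by t^(-2N); with t = |det P|^(1/n) this is |det
    P|^(-2N/n). The function |det S|^(-N/n) is multiplied by the same factor when S becomes P S
    P^T. *)

Section invariant_uniqueness.
Context {R : realType}.
Local Open Scope ereal_scope.

Lemma measure_mono d (T : measurableType d) (mu : {measure set T -> \bar R})
    (A B : set T) :
  measurable A -> measurable B -> A `<=` B -> mu A <= mu B.
Proof. by move=> mA mB AB; rewrite le_measure ?inE. Qed.

(** Fubini and Radon-Nikodym are stated for the bundled structure. The restriction to [setT] is a
    fresh term with the same values, to which the instance can be attached. *)
Lemma sigma_finite_package d (T : measurableType d)
    (mu : {measure set T -> \bar R}) : sigma_finite setT mu ->
  exists m : {sigma_finite_measure set T -> \bar R}, forall A, m A = mu A.
Proof.
move=> sfmu; pose M := mrestr mu (@measurableT _ T).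
have sfM : sigma_finite setT M by rewrite /M /mrestr; under eq_fun do rewrite setIT.
have mM := @Measure_isSigmaFinite.Build _ T R M sfM.
pose m : {sigma_finite_measure set T -> \bar R} := HB.pack M mM.
by exists m => A; rewrite [LHS]/(mu (A `&` setT)) setIT.
Qed.

Lemma indic_section d1 d2 (X : measurableType d1) (Y : measurableType d2)
    (m1 : {sigma_finite_measure set X -> \bar R})
    (m2 : {sigma_finite_measure set Y -> \bar R}) (A : set (X * Y)) :
  measurable A ->
  (\int[m1]_x m2 [set y | A (x, y)] = \int[m2]_y m1 [set x | A (x, y)])%E.
Proof.
move=> mA; have := indic_fubini_tonelli m1 m2 mA.
rewrite (indic_fubini_tonelli_FE m2 mA) (indic_fubini_tonelli_GE m1 mA).
have xE x : xsection A x = [set y | A (x, y)].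
  by apply/seteqP; split=> y; rewrite /xsection /= inE.
have yE y : ysection A y = [set x | A (x, y)].
  by apply/seteqP; split=> x; rewrite /ysection /= inE.
under eq_integral do rewrite /= xE.
by under [RHS]eq_integral do rewrite /= yE.
Qed.

(** The exchange of quantifiers: the product measure of [N] is 0 when computed by sections over [T],
    so almost all sections over [X] are null as well. *)
Lemma ae_section_null d1 d2 (T : measurableType d1) (X : measurableType d2)
    (m1 : {sigma_finite_measure set T -> \bar R})
    (m2 : {sigma_finite_measure set X -> \bar R}) (N : set (T * X)) :
  measurable N -> (forall t, m2 [set x | N (t, x)] = 0) ->
  exists Z, [/\ measurable Z, m2 Z = 0 &
    forall x, ~ Z x -> m1 [set t | N (t, x)] = 0].
Proof.
move=> mN N0.
have mG := measurable_fun_ysection m1 mN.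
have xE t : xsection N t = [set x | N (t, x)].
  by apply/seteqP; split=> x; rewrite /xsection /= inE.
have yE x : ysection N x = [set t | N (t, x)].
  by apply/seteqP; split=> t; rewrite /ysection /= inE.
have int0 : \int[m2]_x (m1 \o ysection N) x = 0.
  rewrite -(indic_fubini_tonelli_GE m1 mN) -(indic_fubini_tonelli m1 m2 mN).
  rewrite (indic_fubini_tonelli_FE m2 mN) integral0_eq// => t _ /=.
  by rewrite xE N0.
have [Z [mZ Z0 sZ]] : ae_eq m2 setT (m1 \o ysection N) (cst 0).
  apply/ae_eq_integral_abs => //.
  by under eq_integral do rewrite gee0_abs//.
exists Z; split => // x Zx; rewrite -yE.
by apply: contra_notP Zx => m1x; apply: sZ => /= /(_ I).
Qed.

(** Radon-Nikodym is applied to the restrictions of [mu] to disjoint pieces of finite measure, and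
    the densities are added. The sum may take the value +oo. *)
Lemma sigma_finite_density d (X : measurableType d)
    (m : {sigma_finite_measure set X -> \bar R})
    (mu : {measure set X -> \bar R}) :
  sigma_finite setT mu -> mu `<< m ->
  exists rho : X -> \bar R, [/\ forall x, 0 <= rho x, measurable_fun setT rho &
    forall A, measurable A -> mu A = \int[m]_(x in A) rho x].
Proof.
move=> [F TF /all_and2[mF muF]] dom.
pose E := seqDU F.
have mE k : measurable (E k).
  by apply: measurableD => //; apply: bigsetU_measurable => *; exact: mF.
have muE k : mu (E k) < +oo.
  by apply: le_lt_trans (muF k); apply: measure_mono => // x [].
have dens k : exists f : X -> \bar R, [/\ forall x, 0 <= f x,
    measurable_fun setT f &
    forall A, measurable A -> mu (A `&` E k) = \int[m]_(x in A) f x].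
  have fin : fin_num_fun (mrestr mu (mE k)).
    move=> A mA; rewrite ge0_fin_numE ?measure_ge0// /mrestr.
    apply: le_lt_trans (muE k); apply: measure_mono => //.
    exact: measurableI.
  pose finM := @Measure_isFinite.Build _ X R (mrestr mu (mE k)) fin.
  pose nu : {finite_measure set X -> \bar R} := HB.pack (mrestr mu (mE k)) finM.
  have numu : nu `<< m.
    apply/null_content_dominatesP => A mA mA0.
    move/null_content_dominatesP : dom => dom.
    apply: (subset_measure0 _ mA _ (dom A mA mA0)) => //.
    exact: measurableI.
  have [f [f0 _ /measurable_int mf fE]] := radon_nikodym_sigma_finite numu.
  by exists f; split.
have /choice[f /all_and3[f0 mf fE]] := dens.
exists (fun x => \sum_(k <oo) f k x); split.
- by move=> x; apply: nneseries_ge0.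
- by apply: ge0_emeasurable_sum.
move=> A mA; rewrite integral_nneseries//; last first.
  by move=> k; exact: measurable_funTS.
under eq_eseriesr do rewrite -fE//.
rewrite -[in LHS](setIT A) TF seqDU_bigcup_eq setI_bigcupr.
rewrite measure_bigcup//.
- apply: eq_eseriesl => k. by rewrite in_setT.
- by move=> k _; apply: measurableI => //; exact: mE.
- exact/trivIset_setIl/trivIset_seqDU.
Qed.

Lemma pushforward_package d1 d2 (X : measurableType d1) (Y : measurableType d2)
    (m1 : {measure set X -> \bar R}) (g : X -> Y) : measurable_fun setT g ->
  exists m2 : {measure set Y -> \bar R}, forall A, m2 A = m1 (g @^-1` A).
Proof.
move=> mg; pose nu : {measure set Y -> \bar R} := pushforward m1 g.
by exists (nu mg).
Qed.

Lemma ge0_integral_comp d1 d2 (X : measurableType d1) (Y : measurableType d2)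
    (m1 : {measure set X -> \bar R}) (m2 : {measure set Y -> \bar R})
    (g : X -> Y) (C : set Y) (f : Y -> \bar R) :
  measurable_fun setT g ->
  (forall A, measurable A -> m1 (g @^-1` A) = m2 A) ->
  measurable C -> measurable_fun C f -> (forall y, 0 <= f y) ->
  \int[m1]_(x in g @^-1` C) f (g x) = \int[m2]_(y in C) f y.
Proof.
move=> mg mE mC mf f0.
rewrite -[LHS](@ge0_integral_pushforward _ _ _ _ _ _ mg)//.
by apply: eq_measure_integral => //= A mA _; exact: mE.
Qed.

Lemma density_package d (X : measurableType d) (m : {measure set X -> \bar R})
    (f : X -> \bar R) :
  measurable_fun setT f -> (forall x, 0 <= f x)%E ->
  exists nu : {measure set X -> \bar R},
    forall A, nu A = (\int[m]_(x in A) f x)%E.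
Proof.
move=> mf f0; pose nu (A : set X) := (\int[m]_(x in A) f x)%E.
have nu0 : nu set0 = 0%E by rewrite /nu integral_set0.
have nu_ge0 A : (0 <= nu A)%E by apply: integral_ge0 => x _; exact: f0.
have nus : semi_sigma_additive nu by exact: semi_sigma_additive_nng_induced.
pose nuM := isMeasure.Build _ X R nu nu0 nu_ge0 nus.
pose nu' : {measure set X -> \bar R} := HB.pack nu nuM.
by exists nu'.
Qed.

Lemma integral_comp d1 d2 (X : measurableType d1) (Y : measurableType d2)
    (m1 : {measure set X -> \bar R}) (m2 : {measure set Y -> \bar R})
    (g : X -> Y) (f : Y -> \bar R) :
  measurable_fun setT g ->
  (forall A, measurable A -> m1 (g @^-1` A) = m2 A) -> measurable_fun setT f ->
  (\int[m1]_x f (g x) = \int[m2]_y f y)%E.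
Proof.
move=> mg mE mf; rewrite integralE [RHS]integralE; congr (_ - _)%E.
  rewrite -(ge0_integral_comp mg mE measurableT (measurable_funepos mf)
    (funepos_ge0 f)) preimage_setT.
  by apply: eq_integral => x _; rewrite !funeposE.
rewrite -(ge0_integral_comp mg mE measurableT (measurable_funeneg mf)
  (funeneg_ge0 f)) preimage_setT.
by apply: eq_integral => x _; rewrite !funenegE.
Qed.

(** On a piece D of this set with finite measure, the integral of rho is at most s m(D) and that of
    rho o g is at least t m(D). Invariance makes both equal to mu(D), so m(D) = 0. *)
Lemma density_invariant d (X : measurableType d)
    (m : {sigma_finite_measure set X -> \bar R})
    (mu : {measure set X -> \bar R}) (rho : X -> \bar R) (g h : X -> X)
    (s t : R) :
  (forall x, 0 <= rho x) -> measurable_fun setT rho ->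
  (forall A, measurable A -> mu A = \int[m]_(x in A) rho x) ->
  measurable_fun setT g -> measurable_fun setT h -> cancel g h ->
  (forall A, measurable A -> m (g @^-1` A) = m A) ->
  (forall A, measurable A -> mu (g @^-1` A) = mu A) ->
  (s < t)%R -> m [set x | rho x <= s%:E /\ t%:E <= rho (g x)] = 0.
Proof.
move=> rho0 mrho rhoE mg mh gK mI muI st.
have mrhog : measurable_fun setT (rho \o g) by exact: measurableT_comp.
set N := [set x | _].
have mN : measurable N.
  have -> : N = (setT `&` [set x | rho x <= s%:E]) `&`
      (setT `&` [set x | t%:E <= (rho \o g) x]).
    by rewrite !setTI.
  by apply: measurableI; [exact: emeasurable_fun_infty_c|
    exact: emeasurable_fun_c_infty].
have [F TF /all_and2[mF mFoo]] := sigma_finiteT m.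
suff NF k : m (N `&` F k) = 0.
  apply/negligibleP => //; rewrite -(setIT N) TF setI_bigcupr.
  by apply: negligible_bigcup => k; apply/negligibleP; [exact: measurableI|exact: NF].
set D := N `&` F k.
have mD : measurable D by exact: measurableI.
have mDoo : m D < +oo.
  by apply: le_lt_trans (mFoo k); apply: measure_mono => // x [].
(* [C] plays the role of the image of [D] under [g]; written as a preimage it is measurable, and
   [gK] gives back [D] as the preimage of [C]. *)
pose C := h @^-1` D.
have mC : measurable C by rewrite -[C]setTI; exact: mh.
have gC : g @^-1` C = D by apply/seteqP; split=> x; rewrite /C /= gK.
have [s0|s0] := ltP s 0%R.
  have -> : D = set0.
    rewrite -subset0 => x [[rs _] _]; have := le_trans (rho0 x) rs.
    by rewrite lee_fin leNgt s0.
  by rewrite measure0.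
have t0 : (0 <= t)%R by rewrite ltW// (le_lt_trans s0).
have lb : t%:E * m D <= \int[m]_(x in D) rho (g x).
  rewrite -integral_cst//; apply: ge0_le_integral => //.
  - exact: (measurable_funTS mrhog).
  - by move=> x [[]].
have ub : \int[m]_(x in D) rho x <= s%:E * m D.
  rewrite -integral_cst//; apply: ge0_le_integral => //.
  - exact: (measurable_funTS mrho).
  - by move=> x [[]].
have mid : \int[m]_(x in D) rho (g x) = \int[m]_(x in D) rho x.
  rewrite -[in LHS]gC (ge0_integral_comp (m2 := m))//; last exact: (measurable_funTS mrho).
  by rewrite -(rhoE C)// -(muI C)// gC rhoE.
have /fineK mDE : m D \is a fin_num by rewrite ge0_fin_numE.
move: lb; rewrite mid => /le_trans/(_ ub).
rewrite -mDE -!EFinM lee_fin -subr_ge0 -mulrBl nmulr_rge0 ?subr_lt0// => le0.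
by congr (_%:E); apply/eqP; rewrite eq_le le0 fine_ge0.
Qed.

(* The hypothesis on the null sets of phi says at once that the action is
   transitive and that phi is quasi-invariant under right translations. *)
Lemma invariant_proportional d1 d2 (T : measurableType d1)
    (X : measurableType d2) (phi : {sigma_finite_measure set T -> \bar R})
    (m : {sigma_finite_measure set X -> \bar R})
    (mu : {measure set X -> \bar R}) (a b : T -> X -> X) :
  phi setT != 0 ->
  measurable_fun setT (fun z : T * X => a z.1 z.2) ->
  (forall t, measurable_fun setT (b t)) ->
  (forall t, cancel (a t) (b t)) ->
  (forall A x y, measurable A ->
     phi [set t | A (a t x)] = 0 -> phi [set t | A (a t y)] = 0) ->
  sigma_finite setT mu -> mu `<< m ->
  (forall t A, measurable A -> m (a t @^-1` A) = m A) ->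
  (forall t A, measurable A -> mu (a t @^-1` A) = mu A) ->
  exists2 c : R, (0 <= c)%R & forall A, measurable A -> mu A = c%:E * m A.
Proof.
move=> phi0 ma mb aK qinv sfmu dom mI muI.
have [rho [rho0 mrho rhoE]] := sigma_finite_density sfmu dom.
have ma1 t : measurable_fun setT (a t).
  exact: (measurable_fun_pair2 t ma).
have mle s : measurable [set x | rho x <= s%:E].
  by rewrite -[X in measurable X]setTI; exact: emeasurable_fun_infty_c.
have mge t : measurable [set x | t%:E <= rho x].
  by rewrite -[X in measurable X]setTI; exact: emeasurable_fun_c_infty.
(* If rho <= s on a non-null set, Fubini finds a point x1 of it with rho (a u x1) < t for almost all
   u. By [qinv] this holds for every y in place of x1. A second use of Fubini fixes one u for which
   rho (a u y) < t for almost all y, and the invariance of m removes u. *)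
have dich s t : (s < t)%R ->
    m [set x | rho x <= s%:E] = 0 \/ m [set x | t%:E <= rho x] = 0.
  move=> st; have [?|/eqP ms0] := eqVneq (m [set x | rho x <= s%:E]) 0.
    by left.
  right; pose N := [set z : T * X | rho z.2 <= s%:E /\ t%:E <= rho (a z.1 z.2)].
  have mN : measurable N.
    have -> : N = (snd @^-1` [set x | rho x <= s%:E]) `&`
        ((fun z : T * X => a z.1 z.2) @^-1` [set x | t%:E <= rho x]) by [].
    apply: measurableI; rewrite -[X in measurable X]setTI; last exact: ma.
    exact: measurable_snd.
  have [Z [mZ Z0 sZ]] : exists Z, [/\ measurable Z, m Z = 0 &
      forall x, ~ Z x -> phi [set u | N (u, x)] = 0].
    apply: ae_section_null => // u.
    exact: (density_invariant rho0 mrho rhoE (ma1 u) (mb u) (aK u)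
      (mI u) (muI u) st).
  have [x1 [x1s x1Z]] : exists x1, rho x1 <= s%:E /\ ~ Z x1.
    apply: contrapT => h; apply: ms0; apply: (subset_measure0 _ mZ) => //.
    by move=> x xs; apply: contrapT => xZ; apply: h; exists x.
  have allx y : phi [set u | t%:E <= rho (a u y)] = 0.
    apply: (qinv [set x | t%:E <= rho x] x1) => //.
    rewrite -[RHS](sZ x1)//; congr (phi _).
    by apply/seteqP; split=> u /= => [|[]].
  pose N' := [set z : X * T | t%:E <= rho (a z.2 z.1)].
  have mN' : measurable N'.
    have -> : N' = ((fun z : T * X => a z.1 z.2) \o (fun z => (z.2, z.1))) @^-1`
      [set x | t%:E <= rho x] by [].
    rewrite -[X in measurable X]setTI.
    by apply: (measurableT_comp ma) => //; exact: measurable_swap.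
  have [Z' [mZ' Z'0 sZ']] := ae_section_null m mN' allx.
  have [u uZ'] : exists u, ~ Z' u.
    apply: contrapT => h; move/eqP: phi0; apply.
    rewrite -[RHS]Z'0; congr (phi _); apply/seteqP; split=> // u _.
    by apply: contrapT => uZ; apply: h; exists u.
  by rewrite -(mI u)//; exact: sZ'.
have [m0|m0] := eqVneq (m setT) 0.
  exists 0%R => // A mA; rewrite mul0e; move/null_content_dominatesP: dom.
  by apply=> //; exact: (subset_measure0 mA _ _ m0).
(* The supremum of [S] will be the almost everywhere constant value of rho. *)
pose S := [set s : R | m [set x | rho x <= s%:E] = 0].
have S0 s : (s < 0)%R -> S s.
  move=> s0; rewrite /S /=; apply/eqP; rewrite -measure_le0.
  rewrite (_ : [set x | _] = set0) ?measure0//.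
  rewrite -subset0 => x /= /(le_trans (rho0 x)).
  by rewrite lee_fin leNgt s0.
have Sdown s t : S t -> (s <= t)%R -> S s.
  move=> St st; apply: (subset_measure0 _ _ _ St) => // x /=.
  by move=> /le_trans; apply; rewrite lee_fin.
(* Otherwise rho would be infinite almost everywhere, although it is integrable on each [F k], where
   mu is finite. *)
have [M SM] : exists M, ~ S M.
  apply: contrapT => h.
  have {}h n : S n%:R by apply: contrapT => nS; apply: h; exists n%:R.
  have [F TF /all_and2[mF muF]] := sfmu.
  move/eqP: m0; apply; apply/negligibleP => //; rewrite TF.
  apply: negligible_bigcup => k.
  have irho : m.-integrable (F k) rho.
    apply/integrableP; split; first exact: measurable_funTS.
    by under eq_integral do rewrite gee0_abs//; rewrite -rhoE.
  have [B [mB B0 sB]] := integrable_ae (mF k) irho.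
  apply: (@negligibleS _ _ _ _ (B `|` \bigcup_n [set x | rho x <= n%:R%:E])).
    move=> x Fx; have [xB|xB] := pselect (B x); [by left|right].
    have : rho x \is a fin_num.
      by apply: contrapT => rx; apply: xB; apply: sB => /= /(_ Fx).
    move=> /fineK rx; exists (Num.truncn (fine (rho x))).+1 => //=.
    by rewrite -rx lee_fin ltW// truncnS_gt.
  apply: negligibleU; first by exists B; split.
  by apply: negligible_bigcup => n; apply/negligibleP => //; exact: h.
have ubS : has_sup S.
  split; first by exists (-1)%R; apply: S0; rewrite ltrN10.
  exists M => s Ss; rewrite leNgt; apply/negP => Ms; apply: SM.
  exact: Sdown Ss (ltW Ms).
pose c := sup S.
have c0 : (0 <= c)%R.
  rewrite leNgt; apply/negP => c0.
  have : S (c / 2)%R by apply: S0; rewrite pmulr_llt0// invr_gt0.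
  move=> /(ub_le_sup ubS.2); rewrite -/c; lra.
have ltc : m.-negligible [set x | rho x < c%:E].
  apply: (@negligibleS _ _ _ _
     (\bigcup_n [set x | rho x <= (c - n.+1%:R^-1)%:E])).
    move=> x /= xc; have rx : rho x = (fine (rho x))%:E.
      by rewrite fineK// ge0_fin_numE// (lt_trans xc) ?ltry.
    move: xc; rewrite rx lte_fin => xc.
    have /ltr_add_invr[n nc] := xc; exists n => //=.
    by rewrite rx lee_fin lerBrDr ltW.
  apply: negligible_bigcup => n; apply/negligibleP => //.
  have [//|s Ss cs] := @sup_adherent _ S n.+1%:R^-1 _ ubS.
  exact: Sdown Ss (ltW cs).
have gtc : m.-negligible [set x | c%:E < rho x].
  apply: (@negligibleS _ _ _ _
     (\bigcup_n [set x | (c + n.+1%:R^-1)%:E <= rho x])).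
    move=> x /=; case rx : (rho x) => [r| |] //=.
      by rewrite lte_fin => /ltr_add_invr[n nr]; exists n => //=; rewrite rx lee_fin ltW.
    by exists 0%N => //=; rewrite rx leey.
  apply: negligible_bigcup => n; apply/negligibleP => //.
  (* The dichotomy needs two distinct levels above c. Its first alternative would put the lower one
     in [S], beyond the supremum. *)
  have [||//] := dich (c + n.+2%:R^-1)%R (c + n.+1%:R^-1)%R _.
    by rewrite ltrD2l ltf_pV2 ?posrE// ltr_nat.
  move=> /(ub_le_sup ubS.2); rewrite -/c -subr_ge0 opprD addNKr oppr_ge0.
  by rewrite leNgt invr_gt0 ltr0n.
exists c => // A mA; rewrite rhoE// -integral_cst//.
apply: ge0_ae_eq_integral => //.
- exact: (measurable_funTS mrho).
- have := negligibleU ltc gtc.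
  apply: negligibleS => x /= /not_implyP[_ /eqP]; rewrite neq_lt => /orP[]; by [left|right].
Qed.

(** Neither measure is known in advance to dominate the other; their sum dominates both, and each
    turns out to be a positive multiple of it. *)
Theorem invariant_measure_unique d1 d2 (T : measurableType d1)
    (X : measurableType d2) (phi : {sigma_finite_measure set T -> \bar R})
    (mu nu : {measure set X -> \bar R}) (a b : T -> X -> X) :
  phi setT != 0 ->
  measurable_fun setT (fun z : T * X => a z.1 z.2) ->
  (forall t, measurable_fun setT (b t)) ->
  (forall t, cancel (a t) (b t)) ->
  (forall A x y, measurable A ->
     phi [set t | A (a t x)] = 0 -> phi [set t | A (a t y)] = 0) ->
  sigma_finite setT mu -> sigma_finite setT nu ->
  (forall t A, measurable A -> mu (a t @^-1` A) = mu A) ->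
  (forall t A, measurable A -> nu (a t @^-1` A) = nu A) ->
  mu setT != 0 -> nu setT != 0 ->
  exists2 c : R, (0 < c)%R & forall A, measurable A -> mu A = c%:E * nu A.
Proof.
move=> phi0 ma mb aK qinv sfmu sfnu muI nuI mu0 nu0.
have sfm : sigma_finite setT (measure_add mu nu).
  have [F [TF ndF /all_and2[mF muF]]] := (sigma_finiteP _ _).1 sfmu.
  have [G [TG ndG /all_and2[mG nuG]]] := (sigma_finiteP _ _).1 sfnu.
  (* These intersections still cover because both sequences are increasing. *)
  exists (fun n => F n `&` G n).
    apply/seteqP; split => // x _.
    have [i _ Fx] : (\bigcup_i F i) x by rewrite -TF.
    have [j _ Gx] : (\bigcup_i G i) x by rewrite -TG.
    exists (maxn i j) => //; split.
      by have /subsetPset := ndF _ _ (leq_maxl i j); apply.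
    by have /subsetPset := ndG _ _ (leq_maxr i j); apply.
  move=> n; split; first exact: measurableI.
  rewrite measure_addE lte_add_pinfty//.
    by apply: le_lt_trans (muF n); apply: measure_mono => //; exact: measurableI.
  by apply: le_lt_trans (nuG n); apply: measure_mono => //; exact: measurableI.
have [m mE'] := sigma_finite_package sfm.
have mE A : m A = mu A + nu A by rewrite mE'; exact: measure_addE.
have mI t A : measurable A -> m (a t @^-1` A) = m A.
  by move=> mA; rewrite !mE muI// nuI.
have mum : mu `<< m.
  by apply/null_content_dominatesP => A mA; move=> mA0; have /eqP := etrans (esym (mE A)) mA0;
    rewrite padde_eq0// => /andP[/eqP].
have num : nu `<< m.
  by apply/null_content_dominatesP => A mA; move=> mA0; have /eqP := etrans (esym (mE A)) mA0;
    rewrite padde_eq0// => /andP[_ /eqP].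
have [c1 c10 muE] := invariant_proportional phi0 ma mb aK qinv sfmu mum mI muI.
have [c2 c20 nuE] := invariant_proportional phi0 ma mb aK qinv sfnu num mI nuI.
have {}c10 : (0 < c1)%R.
  by rewrite lt_def c10 andbT; apply: contra mu0 => /eqP c1E; rewrite muE// c1E mul0e.
have {}c20 : (0 < c2)%R.
  by rewrite lt_def c20 andbT; apply: contra nu0 => /eqP c2E; rewrite nuE// c2E mul0e.
exists (c1 / c2)%R => [|A mA]; first exact: divr_gt0.
by rewrite nuE// muE// muleA -EFinM divfK// gt_eqF.
Qed.

End invariant_uniqueness.

(** * Borel sets of matrix spaces *)

Section borel.
Context {R : realType}.

Lemma borel_open (T : ptopologicalType) (A : set (borelType T)) :
  @open T A -> measurable A.
Proof. exact: sub_sigma_algebra. Qed.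

Lemma continuous_borel (T T' : ptopologicalType) (f : T -> T') :
  continuous f ->
  measurable_fun setT (f : borelType T -> borelType T').
Proof.
move=> cf; apply: (@measurability _ _ (borelType T) (borelType T') _ _ (@open T') erefl).
move=> _ [B oB <-]; rewrite setTI; apply: borel_open.
by move/continuousP : cf; apply.
Qed.

Lemma continuous_borel_real (T : ptopologicalType) (f : T -> R) :
  continuous f -> measurable_fun setT (f : borelType T -> R).
Proof.
move=> cf; apply: (measurability _ (RGenOpens.measurableE R)).
move=> _ [_ [a [b ->]] <-]; rewrite setTI; apply: borel_open.
by move/continuousP : cf; apply; exact: interval_open.
Qed.

Section matrix_balls.
Context {m n : nat}.
Implicit Types (W : set 'M[R]_(m, n)).

Definition closed_cube (c : 'M[R]_(m, n)) (r : R) : set 'M[R]_(m, n) :=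
  [set y | forall i j, `|y i j - c i j| <= r].

(** Countable basis of cubes with rational centres. Keeping the closed cubes inside [W] provides
    compact subsets later. *)
Lemma open_cubes W : open W ->
  exists (c : nat -> 'M[R]_(m, n)) (r : nat -> R) (P : set nat),
    W = \bigcup_(k in P) ball (c k) (r k) /\
    forall k, P k -> 0 < r k /\ closed_cube (c k) (r k) `<=` W.
Proof.
move=> oW.
(* Each natural number codes a rational centre and a radius; the default for other numbers is
   harmless, since [P] keeps only cubes inside [W]. *)
pose dec k : 'M[rat]_(m, n) * nat := odflt (0, 0%N) (unpickle k).
pose c k : 'M[R]_(m, n) := map_mx ratr (dec k).1.
pose r k : R := (dec k).2.+1%:R^-1.
pose P := [set k | closed_cube (c k) (r k) `<=` W].
exists c, r, P; split; last by move=> k Pk; split => //; rewrite /r invr_gt0.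
apply/seteqP; split=> [x Wx|x [k Pk [_ xk]]]; last first.
  apply: Pk => i j; rewrite distrC; exact: ltW (xk i j).
have [e /= e0 xeW] : exists2 e : R, 0 < e & ball x e `<=` W.
  by apply/nbhs_ballP; apply: open_nbhs_nbhs.
(* Half of e, because two distances are added: from x to the rational centre, and from the centre to
   a point of the cube. *)
have [k ke] : exists k : nat, k.+1%:R^-1 < e / 2.
  have /ltr_add_invr[k] : 0 < e / 2 by rewrite divr_gt0.
  by rewrite add0r => ke; exists k.
have k0 : 0 < k.+1%:R^-1 :> R by rewrite invr_gt0.
have qP ij : exists q : rat, `|x ij.1 ij.2 - ratr q| < k.+1%:R^-1.
  have [|q] := @rat_in_itvoo R (x ij.1 ij.2 - k.+1%:R^-1) (x ij.1 ij.2 + k.+1%:R^-1).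
    by rewrite ltrD2l gtrN.
  by rewrite in_itv /= => qx; exists q; rewrite ltr_distlC.
have [q /= qE] := choice qP.
pose Q : 'M[rat]_(m, n) := \matrix_(i, j) q (i, j).
pose z := pickle (Q, k).
have dz : dec z = (Q, k) by rewrite /dec pickleK.
have cE i j : c z i j = ratr (q (i, j)) by rewrite /c dz !mxE.
have rE : r z = k.+1%:R^-1 by rewrite /r dz.
exists z.
  move=> y yc; apply: xeW; split => // i j; rewrite /ball /=.
  have := yc i j; have := qE (i, j); rewrite /= cE rE => h1 h2.
  rewrite (_ : x i j - y i j = (x i j - ratr (q (i, j))) + (ratr (q (i, j)) - y i j));
    last by lra.
  rewrite (le_lt_trans (ler_normD _ _))// (splitr e) ltrD//.
    exact: lt_trans ke.
  by rewrite distrC (le_lt_trans h2).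
split; first by rewrite rE.
by move=> i j; rewrite /ball /= cE rE distrC; exact: (qE (i, j)).
Qed.

(** A cube is a finite intersection of conditions on single entries, and by [open_cubes] countably
    many cubes make up any open set. *)
Lemma measurable_mx d (T : measurableType d) (f : T -> 'M[R]_(m, n)) :
  (forall i j, measurable_fun setT (fun x => f x i j)) ->
  measurable_fun setT (f : T -> borelType 'M[R]_(m, n)).
Proof.
move=> mf; apply: (@measurability _ _ T (borelType 'M[R]_(m, n)) _ _
  (@open 'M[R]_(m, n)) erefl).
move=> _ [W /open_cubes[c [r [P [-> rP]]]] <-]; rewrite setTI preimage_bigcup.
apply: bigcup_measurable => k /rP[rk0 _].
have -> : f @^-1` ball (c k) (r k) =
    \bigcap_(i in [set: 'I_m]) \bigcap_(j in [set: 'I_n])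
      [set x | `|c k i j - f x i j| < r k].
  apply/seteqP; split=> x.
    by move=> [_ xk] i _ j _; exact: xk.
  by move=> xk; split => // i j; exact: xk.
apply: fin_bigcap_measurable => [|i _]; first exact: finite_finset.
apply: fin_bigcap_measurable => [|j _]; first exact: finite_finset.
have mg : measurable_fun setT (fun x => `|c k i j - f x i j|).
  by apply: measurableT_comp => //; apply: measurable_funB.
rewrite -[X in measurable X]setTI.
have := mg measurableT `]-oo, r k[%classic (measurable_itv _).
by rewrite (_ : _ @^-1` _ = [set x | `|c k i j - f x i j| < r k])//;
  apply/seteqP; split=> x /=; rewrite in_itv.
Qed.

Lemma measurable_coord (i : 'I_m) (j : 'I_n) :
  measurable_fun setT (fun M : borelType 'M[R]_(m, n) => M i j).
Proof. by apply: continuous_borel_real; exact: coord_continuous. Qed.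

End matrix_balls.

Lemma measurable_mulmxr m n p (M : 'M[R]_(n, p)) :
  measurable_fun setT
    (fun x : borelType 'M[R]_(m, n) => x *m M : borelType 'M[R]_(m, p)).
Proof.
apply: measurable_mx => i j; under eq_fun do rewrite mxE.
apply: measurable_sum => k; apply: measurable_funM => //.
exact: measurable_coord.
Qed.

End borel.

(** * Lebesgue measure on row vectors *)

Section lebesgue.
Context {R : realType}.

(** Lebesgue measure through translation invariance and its normalisation on cubes, which also gives
    finiteness on bounded sets. *)
Definition is_lebesgue N (mu : {measure set (borelType 'rV[R]_N) -> \bar R}) :=
  (forall (v : 'rV[R]_N) (A : set (borelType 'rV[R]_N)), measurable A ->
     mu [set x : 'rV[R]_N | A (v + x)] = mu A) /\
  (forall r : R, 0 <= r -> mu (closed_cube 0 r) = ((2 * r) ^+ N)%:E).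

Lemma measurable_le_cst d (T : measurableType d) (g : T -> R) r :
  measurable_fun setT g -> measurable [set x | g x <= r].
Proof.
move=> mg; rewrite (_ : [set x | _] = setT `&` g @^-1` `]-oo, r]%classic).
  exact: mg.
by rewrite setTI; apply/seteqP; split=> x /=; rewrite in_itv.
Qed.

Lemma measurable_closed_cube m n (c : 'M[R]_(m, n)) r :
  measurable (closed_cube c r : set (borelType 'M[R]_(m, n))).
Proof.
have -> : closed_cube c r = \bigcap_(i in [set: 'I_m]) \bigcap_(j in [set: 'I_n])
    [set x | `|x i j - c i j| <= r].
  by apply/seteqP; split=> x xr; [move=> i _ j _; exact: xr|
    move=> i j; exact: (xr i I j I)].
apply: fin_bigcap_measurable => [|i _]; first exact: finite_finset.
apply: fin_bigcap_measurable => [|j _]; first exact: finite_finset.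
apply: measurable_le_cst; apply: measurableT_comp => //.
by apply: measurable_funB => //; exact: measurable_coord.
Qed.

Lemma cover_closed_cube m n :
  [set: 'M[R]_(m, n)] = \bigcup_k closed_cube 0 k%:R.
Proof.
apply/seteqP; split=> // x _.
have [k xk] : exists k : nat, forall i j, `|x i j| <= k%:R.
  exists (Num.truncn (\sum_i \sum_j `|x i j|)).+1 => i j.
  apply: le_trans (ltW (truncnS_gt _)).
  rewrite (bigD1 i)//= (bigD1 j)//= -addrA lerDl addr_ge0// ?sumr_ge0// => k _.
  by rewrite sumr_ge0.
by exists k => // i j; rewrite mxE subr0.
Qed.

Lemma lebesgue_sigma_finite N mu : @is_lebesgue N mu -> sigma_finite setT mu.
Proof.
move=> [_ muc]; exists (fun k => closed_cube 0 k%:R).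
  exact: cover_closed_cube.
by move=> k; split; [exact: measurable_closed_cube|rewrite muc// ltry].
Qed.

Lemma lebesgue_measure_translate (t : R) (A : set (measurableTypeR R)) :
  measurable A -> lebesgue_measure [set x : R | A (t + x)] = lebesgue_measure A.
Proof.
move=> mA; change (pushforward (@lebesgue_measure R)
  ((fun x : R => t + x) : measurableTypeR R -> measurableTypeR R) A =
  lebesgue_measure A).
have mt : measurable_fun setT ((fun x : R => t + x) : measurableTypeR R -> measurableTypeR R).
  exact: measurable_funD.
apply/esym/lebesgue_measure_unique => //= _ [[a b]] _ <-.
rewrite /pushforward (_ : _ @^-1` _ = `]a - t, b - t]%classic); last first.
  by apply/seteqP; split=> x /=; rewrite !in_itv /= ltrBlDl lerBrDl.
rewrite !lebesgue_measure_itv /= !lte_fin ltrD2r.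
by case: ifP => // _; congr (_%:E); lra.
Qed.

(** Induction on N: a Dirac mass in dimension 0, then the product with Lebesgue measure on the line,
    carried to row vectors by [row_mx]. *)
Lemma lebesgue_exists N : exists mu, @is_lebesgue N mu.
Proof.
elim: N => [|N [mu muL]].
  exists (@dirac _ (borelType 'rV[R]_0) (0 : 'rV[R]_0) R : {measure set _ -> \bar R}).
  split=> [v A mA|r r0].
    rewrite (_ : [set x | _] = A)//; apply/seteqP.
    by split=> x /=; rewrite (thinmx0 (v + x)) (thinmx0 x).
  by rewrite /= diracE expr0 mem_set// => i [].
change (exists nu, @is_lebesgue (1 + N) nu).
have [m mE] := sigma_finite_package (lebesgue_sigma_finite muL).
have [muT muc] := muL.
pose f (z : measurableTypeR R * borelType 'rV[R]_N) : borelType 'rV[R]_(1 + N) :=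
  row_mx (z.1%:M : 'M[R]_1) (z.2 : 'rV[R]_N).
have fl z i (j : 'I_1) : f z i (lshift N j) = z.1.
  by rewrite /f row_mxEl !ord1 mxE eqxx mulr1n.
have fr z i (j : 'I_N) : f z i (rshift 1 j) = (z.2 : 'rV[R]_N) 0 j.
  by rewrite /f row_mxEr !ord1.
have mf : measurable_fun setT f.
  apply: measurable_mx => i j; rewrite -(splitK j); case: (fintype.split j) => k /=.
    by under eq_fun do rewrite fl; exact: measurable_fst.
  under eq_fun do rewrite fr.
  exact: (measurableT_comp (measurable_coord 0 k) measurable_snd).
pose L := @lebesgue_measure R : {sigma_finite_measure set (measurableTypeR R) -> \bar R}.
have [nu nuE] := pushforward_package (L \x m)%E mf.
exists nu; split=> [v A mA|r r0]; rewrite !nuE.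
  have mfA : measurable (f @^-1` A) by rewrite -[X in measurable X]setTI; exact: mf.
  rewrite /product_measure1 /=.
  pose v1 : R := v 0 (lshift N 0); pose v2 : 'rV[R]_N := rsubmx v.
  have fv t x : v + f (t, x) = f (v1 + t, v2 + x).
    apply/rowP => j; rewrite mxE -(splitK j); case: (fintype.split j) => k /=.
      by rewrite !fl /v1 !ord1.
    by rewrite !fr /= !mxE.
  pose g t := m [set x | A (f (t, x))].
  have xE t : xsection (f @^-1` A) t = [set x | A (f (t, x))].
    by apply/seteqP; split=> x; rewrite /xsection /= inE.
  (* The translation by [v2] is absorbed in the inner measure, then the one by [v1] in the outer
     integral. *)
  transitivity (\int[L]_t g (v1 + t)%R)%E.
    apply: eq_integral => t _ /=; rewrite /g mE -[RHS](muT v2); last first.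
      by rewrite -xE; exact: measurable_xsection.
    rewrite mE; congr (mu _); apply/seteqP; split=> x; rewrite /xsection /= inE /=.
      by rewrite fv.
    by rewrite -fv.
  transitivity (\int[L]_t g t)%E.
    rewrite -[in LHS](preimage_setT (fun t : measurableTypeR R => v1 + t)).
    apply: (ge0_integral_comp (m2 := L)) => //.
    - exact: measurable_funD.
    - by move=> B mB; exact: lebesgue_measure_translate.
    - have := measurable_fun_xsection m mfA.
      by apply: eq_measurable_fun => t _; rewrite /= xE.
  by apply: eq_integral => t _; rewrite /= xE.
rewrite (_ : f @^-1` _ = `[-r, r]%classic `*` closed_cube 0 r); last first.
  apply/seteqP; split=> [z zr|z [/= zr1 zr2] i j].
    split.
      have := zr 0 (lshift N 0); rewrite fl mxE subr0 /=.
      by rewrite in_itv /= ler_norml.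
    move=> i j; have := zr i (rshift 1 j).
    by rewrite fr !mxE !ord1.
  rewrite -(splitK j); case: (fintype.split j) => k /=.
    by rewrite fl mxE subr0 ler_norml; move: zr1; rewrite in_itv.
  by rewrite fr !mxE; have := zr2 0 k; rewrite mxE.
rewrite [LHS](product_measure1E L m (measurable_itv _) (measurable_closed_cube 0 r)).
rewrite /= mE muc// lebesgue_measure_itv /= lte_fin.
case: ifPn => [_|].
  by rewrite -EFinB -EFinM exprS; congr ((_ * _)%:E); lra.
rewrite -leNgt => rr; have -> : r = 0 by lra.
by rewrite mulr0 exprS mul0r mul0e.
Qed.

Lemma measurable_mx_add d (X : measurableType d) m n
    (f g : X -> 'M[R]_(m, n)) :
  measurable_fun setT (f : X -> borelType 'M[R]_(m, n)) ->
  measurable_fun setT (g : X -> borelType 'M[R]_(m, n)) ->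
  measurable_fun setT (fun x => f x + g x : borelType 'M[R]_(m, n)).
Proof.
move=> mf mg; apply: measurable_mx => i j; under eq_fun do rewrite mxE.
apply: measurable_funD.
  exact: (measurableT_comp (measurable_coord i j) mf).
exact: (measurableT_comp (measurable_coord i j) mg).
Qed.

Lemma measurable_mx_opp d (X : measurableType d) m n (f : X -> 'M[R]_(m, n)) :
  measurable_fun setT (f : X -> borelType 'M[R]_(m, n)) ->
  measurable_fun setT (fun x => - f x : borelType 'M[R]_(m, n)).
Proof.
move=> mf; apply: measurable_mx => i j; under eq_fun do rewrite mxE.
apply: measurableT_comp => //.
exact: (measurableT_comp (measurable_coord i j) mf).
Qed.

Lemma integral_indic_mul d (X : measurableType d)
    (m : {measure set X -> \bar R}) (k : \bar R) (B : set X) :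
  measurable B -> (0 <= k)%E ->
  (\int[m]_x ((\1_B x)%:E * k) = k * m B)%E.
Proof.
move=> mB k0; rewrite ge0_integralZr//; last exact/measurable_EFinP.
by rewrite integral_indic// setIT muleC.
Qed.

Lemma lebesgue_open_neq0 N (lam : {measure set (borelType 'rV[R]_N) -> \bar R})
    (W : set 'rV[R]_N) x : is_lebesgue lam -> open W -> W x -> lam W != 0.
Proof.
move=> [lT lc] oW; have mW : measurable (W : set (borelType 'rV[R]_N)) by exact: borel_open.
have [c [r [P [WE rP]]]] := open_cubes oW; rewrite {1}WE => -[k Pk _].
have [r0 cW] := rP k Pk.
have : (0 < lam (closed_cube (c k) (r k)))%E.
  rewrite (_ : closed_cube (c k) (r k) = [set y | closed_cube 0 (r k) (- c k + y)]).
    rewrite lT; last exact: measurable_closed_cube.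
    by rewrite lc ?ltW// lte_fin exprn_gt0// mulr_gt0.
  by apply/seteqP; split=> y yr i j; have := yr i j; rewrite !mxE subr0 addrC.
move=> l0; rewrite gt_eqF//; apply: lt_le_trans l0 _.
by apply: measure_mono => //; exact: measurable_closed_cube.
Qed.

(** * Proportionality of translation-invariant measures *)

Section translation_invariance.
Context {N : nat}.
Local Notation T := (borelType 'rV[R]_N).
Variables mu nu : {sigma_finite_measure set T -> \bar R}.
Hypothesis muT : forall (v : 'rV[R]_N) (A : set T), measurable A ->
  mu [set x : 'rV[R]_N | A (v + x)] = mu A.
Hypothesis nuT : forall (v : 'rV[R]_N) (A : set T), measurable A ->
  nu [set x : 'rV[R]_N | A (v + x)] = nu A.

(* Fubini for the set of pairs (x, y) such that x + y is in A and y is in B. *)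
Lemma translation_invariant_mul (A B : set T) :
  measurable A -> measurable B -> (forall x : 'rV[R]_N, B x -> B (- x)) ->
  (mu A * nu B = nu A * mu B)%E.
Proof.
move=> mA mB Bsym.
pose sum (z : T * T) : T := (z.1 : 'rV[R]_N) + (z.2 : 'rV[R]_N).
pose diff (z : T * T) : T := (z.2 : 'rV[R]_N) - (z.1 : 'rV[R]_N).
have msum : measurable_fun setT sum.
  by apply: measurable_mx_add; [exact: measurable_fst|exact: measurable_snd].
have mdiff : measurable_fun setT diff.
  by apply: measurable_mx_add; [exact: measurable_snd|
    apply: measurable_mx_opp; exact: measurable_fst].
have mpre d1 d2 (X : measurableType d1) (Y : measurableType d2) (f : X -> Y) C :
    measurable_fun setT f -> measurable C -> measurable (f @^-1` C).
  by move=> mf mC; rewrite -[X in measurable X]setTI; exact: mf.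
transitivity (\int[nu]_y mu [set x | (sum @^-1` A `&` snd @^-1` B) (x, y)])%E.
  rewrite -[LHS](@integral_indic_mul _ _ nu (mu A) B)//; apply: eq_integral => y _.
  rewrite indicE; case: (boolP (y \in B)) => [|] yB.
    rewrite mul1e -(muT y)//; congr (mu _).
    rewrite inE in yB; apply/seteqP.
    by split=> x /=; rewrite /sum /= (addrC _ x); [|case].
  rewrite mul0e -[LHS](@measure0 _ _ _ mu); congr (mu _).
  apply/seteqP; split=> x // -[_ /=].
  by move: yB; rewrite notin_setE => yB /yB.
rewrite -indic_section; last first.
  by apply: measurableI; apply: mpre => //; exact: measurable_snd.
transitivity (\int[mu]_x nu [set y | (snd @^-1` A `&` diff @^-1` B) (x, y)])%E.
  apply: eq_integral => x _.
  rewrite -[RHS](nuT x); last first.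
    apply: (mpre _ _ _ _ (pair x)) => //.
    by apply: measurableI; apply: mpre => //; exact: measurable_snd.
  congr (nu _); apply/seteqP; split=> y /=; rewrite /sum /diff /=.
    by rewrite addrAC subrr add0r.
  by rewrite addrAC subrr add0r.
rewrite indic_section; last first.
  by apply: measurableI; apply: mpre => //; exact: measurable_snd.
rewrite -[RHS]muleC -[RHS](@integral_indic_mul _ _ nu (mu B) A)//.
apply: eq_integral => y _; rewrite indicE; case: (boolP (y \in A)) => [|] yA.
  rewrite mul1e -[RHS](muT (- (y : 'rV[R]_N)))//; congr (mu _).
  apply/seteqP; split=> x /=; rewrite /diff /=.
    by move=> [_ /Bsym]; rewrite opprB addrC.
  move=> /Bsym yx; split; first by rewrite inE in yA.
  by move: yx; rewrite opprD opprK.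
rewrite mul0e -[RHS](@measure0 _ _ _ mu); congr (mu _).
apply/seteqP; split=> x // -[/= + _].
by move: yA; rewrite notin_setE => yA /yA.
Qed.

End translation_invariance.

(** * Lebesgue measure under linear automorphisms *)

Section scaling.
Context {N : nat}.
Local Notation T := (borelType 'rV[R]_N).
Variable lam : {measure set (borelType 'rV[R]_N) -> \bar R}.
Hypothesis lamL : is_lebesgue lam.

(** The image of [lam] under [M] is again translation invariant, hence proportional to [lam]; the
    symmetric set used for the comparison is the unit cube. *)
Lemma lebesgue_mulmx (M : 'M[R]_N) : M \in unitmx ->
  exists2 c : R, 0 < c & forall A : set (borelType 'rV[R]_N), measurable A ->
    lam [set x : 'rV[R]_N | A (x *m M)] = (c%:E * lam A)%E.
Proof.
move=> uM.
have [lT lc] := lamL.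
have mM := @measurable_mulmxr R 1 N N M.
have [m mE] := sigma_finite_package (lebesgue_sigma_finite lamL).
have [nu nuE] := pushforward_package lam mM.
have mpre (K : 'M[R]_N) (A : set T) : measurable A ->
    measurable ([set x : 'rV[R]_N | A (x *m K)] : set T).
  by move=> mA; have := @measurable_mulmxr R 1 N N K measurableT A mA; rewrite setTI.
pose B : set T := closed_cube 0 1.
have mB : measurable B by exact: measurable_closed_cube.
have bounded (K : 'M[R]_N) k : exists r : R, 0 <= r /\
    forall x : 'rV[R]_N, closed_cube 0 k x -> closed_cube 0 r (x *m K).
  exists (`|k| * \sum_i \sum_j `|K i j|); split.
    by rewrite mulr_ge0// sumr_ge0// => i _; rewrite sumr_ge0.
  move=> x xk i j; rewrite [X in _ - X]mxE subr0 mxE.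
  apply: le_trans (ler_norm_sum _ _ _) _; rewrite mulr_sumr.
  apply: ler_sum => l _; rewrite normrM ler_pM//.
    by have := xk i l; rewrite mxE subr0 => /le_trans; apply; exact: ler_norm.
  by rewrite (bigD1 j)//= lerDl sumr_ge0.
have nufin k : (nu (closed_cube 0 k) < +oo)%E.
  have [r [r0 kr]] := bounded (invmx M) k.
  rewrite nuE; apply: (@le_lt_trans _ _ (lam (closed_cube 0 r))).
    apply: measure_mono; [exact: (mpre M _ (measurable_closed_cube 0 k))|
      exact: measurable_closed_cube|].
    by move=> x /= /kr; rewrite mulmxK.
  by rewrite lc// ltry.
have sfnu : sigma_finite setT nu.
  exists (fun k => closed_cube 0 k%:R); first exact: cover_closed_cube.
  by move=> k; split => //; exact: measurable_closed_cube.
have [n nE] := sigma_finite_package sfnu.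
have nT (v : 'rV[R]_N) (A : set T) : measurable A ->
    n [set x : 'rV[R]_N | A (v + x)] = n A.
  move=> mA; rewrite !nE !nuE -[RHS](lT (v *m invmx M)); last exact: mpre.
  by congr (lam _); apply/seteqP; split=> x /=; rewrite mulmxDl mulmxKV.
have mT (v : 'rV[R]_N) (A : set T) : measurable A ->
    m [set x : 'rV[R]_N | A (v + x)] = m A.
  by move=> mA; rewrite !mE; exact: lT.
have Bsym (x : 'rV[R]_N) : B x -> B (- x).
  by move=> xB i j; have := xB i j; rewrite !mxE !subr0 normrN.
have key (A : set T) : measurable A -> (nu A * lam B = lam A * nu B)%E.
  by move=> mA; have := translation_invariant_mul nT mT mA mB Bsym; rewrite !nE !mE.
have lB : lam B = ((2 * 1) ^+ N)%:E by rewrite lc.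
have two0 : 0 < (2 * 1) ^+ N :> R by rewrite exprn_gt0// mulr1.
have nuB : nu B = (fine (nu B))%:E by rewrite fineK// ge0_fin_numE// nufin.
exists (fine (nu B) / (2 * 1) ^+ N).
  rewrite divr_gt0// lt_def fine_ge0// andbT; apply/eqP => nB0.
  (* This is the image of the cube under [M], and its [nu]-measure is [lam B]. Were [nu B] zero,
     [key] would give [lam B] times itself equal to zero. *)
  have mC : measurable (([set x : 'rV[R]_N | B (x *m invmx M)]) : set T).
    exact: mpre.
  have := key _ mC; rewrite nuB nB0 mule0 lB nuE.
  rewrite (_ : _ @^-1` _ = B); last first.
    by apply/seteqP; split=> x /=; rewrite mulmxK.
  by rewrite lB -EFinM => -[/eqP]; rewrite mulf_eq0 orbb gt_eqF.
move=> A mA; rewrite -[LHS](nuE A).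
have := key A mA; rewrite lB nuB => h.
have : (nu A * ((2 * 1) ^+ N)%:E * (((2 * 1) ^+ N)^-1)%:E = nu A)%E.
  by rewrite -muleA -EFinM divff ?mule1// gt_eqF.
by move=> <-; rewrite h -muleA -EFinM muleC.
Qed.

Lemma lebesgue_scale (t : R) (c : R) : 0 < t ->
  (forall A : set (borelType 'rV[R]_N), measurable A ->
    lam [set x : 'rV[R]_N | A (t *: x)] = (c%:E * lam A)%E) ->
  c = t ^- N.
Proof.
move=> t0 tc; have [lT lc] := lamL.
have := tc _ (measurable_closed_cube 0 1); rewrite lc//.
rewrite (_ : [set x | _] = closed_cube 0 t^-1); last first.
  apply/seteqP; split=> x xt i j; have := xt i j; rewrite !mxE !subr0.
    by rewrite normrM gtr0_norm// mulrC -ler_pdivlMr// div1r.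
  by rewrite normrM gtr0_norm// mulrC -(div1r t) ler_pdivlMr.
rewrite lc ?invr_ge0 ?ltW// -EFinM => -[].
rewrite !exprMn expr1n mulr1 mulrC => /mulIf <-; first by rewrite exprVn.
by rewrite expf_neq0// pnatr_eq0.
Qed.

End scaling.

End lebesgue.

(** * Linear algebra *)

Section unimodular.
Context {R : realFieldType}.

Let up m (b : 'rV[R]_m) : 'M[R]_(1 + m) := block_mx 1%:M b 0 1%:M.
Let lo m (c : 'cV[R]_m) : 'M[R]_(1 + m) := block_mx 1%:M 0 c 1%:M.

Let det_up m (b : 'rV[R]_m) : \det (up b) = 1.
Proof. by rewrite det_ublock !det1 mulr1. Qed.

Let det_lo m (c : 'cV[R]_m) : \det (lo c) = 1.
Proof. by rewrite det_lblock !det1 mulr1. Qed.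

Lemma mul_pos_idem (x : R) : 0 < x -> x = x * x -> x = 1.
Proof.
move=> x0 xx; apply: (@mulfI _ x); first by rewrite gt_eqF.
by rewrite mulr1 -xx.
Qed.

(** Since f is positive and commutative-valued, conjugation does not change it, so a value equal to
    its own square is 1 and f is trivial on [up] and [lo]. Block elimination with these reduces A to
    a smaller matrix of determinant 1. *)
Lemma multiplicative_det1 n (f : 'M[R]_n -> R) :
  (forall A, A \in unitmx -> 0 < f A) ->
  (forall A B, A \in unitmx -> B \in unitmx -> f (A *m B) = f A * f B) ->
  forall A, \det A = 1 -> f A = 1.
Proof.
have f1 k (f' : 'M[R]_k -> R) : (forall A, A \in unitmx -> 0 < f' A) ->
    (forall A B, A \in unitmx -> B \in unitmx -> f' (A *m B) = f' A * f' B) ->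
    f' 1%:M = 1.
  move=> fpos fM; apply: mul_pos_idem; first by rewrite fpos// unitmx1.
  by rewrite -fM ?unitmx1// mulmx1.
elim: n f => [|m IH] f fpos fM A dA.
  by rewrite (flatmx0 A) -(flatmx0 1%:M) f1.
change (nat_of_bool true + m)%N with (1 + m)%N in *.
move: f fpos fM A dA; change m.+1 with (1 + m)%N => f fpos fM A dA.
have det1U (B : 'M[R]_(1 + m)) : \det B = 1 -> B \in unitmx.
  by rewrite unitmxE => ->; exact: unitr1.
(* Conjugation by D2 maps a transvection to its square, or conversely. *)
pose D2 : 'M[R]_(1 + m) := block_mx 2%:M 0 0 1%:M.
have D2U : D2 \in unitmx.
  by rewrite unitmxE det_lblock det1 mulr1 det_scalar unitrX ?unitfE// pnatr_eq0.
have fup b : f (up b) = 1.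
  have uU := det1U _ (det_up b).
  apply: mul_pos_idem; first exact: fpos.
  apply: (@mulIf _ (f D2)); first by rewrite gt_eqF ?fpos.
  rewrite [LHS]mulrC -!fM ?unitmx_mul ?uU ?D2U//; congr f.
  rewrite /up /D2 !mulmx_block !(mulmx1, mul1mx, mul0mx, mulmx0, addr0, add0r).
  by rewrite mul_scalar_mx scaler_nat.
have flo c : f (lo c) = 1.
  have uU := det1U _ (det_lo c).
  apply: mul_pos_idem; first exact: fpos.
  apply: (@mulfI _ (f D2)); first by rewrite gt_eqF ?fpos.
  rewrite [LHS]mulrC mulrA -!fM ?unitmx_mul ?uU ?D2U//; congr f.
  rewrite /lo /D2 !mulmx_block !(mulmx1, mul1mx, mul0mx, mulmx0, addr0, add0r).
  by rewrite mul_mx_scalar scaler_nat.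
(* With corner 1, B factors as [lo], a block diagonal matrix and [up]; the block [B'] has
   determinant 1 and falls under the induction hypothesis. *)
have pivot1 B : \det B = 1 -> ulsubmx B = 1%:M -> f B = 1.
  move=> dB B1.
  pose r := ursubmx B; pose c := dlsubmx B.
  pose B' := drsubmx B - c *m r.
  have BE : B = lo c *m block_mx 1%:M 0 0 B' *m up r.
    rewrite /lo /up !mulmx_block !(mulmx1, mul1mx, mul0mx, mulmx0, addr0, add0r).
    by rewrite -[LHS]submxK B1 /B' addrC subrK.
  have dB' : \det B' = 1.
    move: dB; rewrite BE !det_mulmx det_up det_lo mulr1 mul1r.
    by rewrite det_lblock det1 mul1r.
  have dl (C : 'M[R]_m) : \det (block_mx 1%:M 0 0 C : 'M[R]_(1 + m)) = \det C.
    by rewrite det_lblock det1 mul1r.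
  rewrite BE !fM ?unitmx_mul ?det1U ?det_up ?det_lo ?dl//.
  rewrite fup flo mulr1 mul1r.
  apply: (IH (fun C => f (block_mx 1%:M 0 0 C))) => // [C CU|C C' CU C'U].
    by apply: fpos; rewrite unitmxE dl.
  rewrite -fM ?unitmxE ?dl//; congr f.
  by rewrite mulmx_block !(mulmx1, mul1mx, mul0mx, mulmx0, addr0, add0r).
(* A nonzero entry below the corner allows a multiple of its row to be added to the first row so
   that the corner becomes 1. *)
have corner B : \det B = 1 -> dlsubmx B != 0 -> f B = 1.
  move=> dB /matrix0Pn[i [j ci]]; rewrite ord1 {j} in ci *.
  set c := dlsubmx B in ci.
  pose b : 'rV[R]_m := ((1 - ulsubmx B 0 0) / c i 0) *: delta_mx 0 i.
  have -> : f B = f (up b *m B).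
    by rewrite fM ?det1U ?det_up// fup mul1r.
  apply: pivot1; first by rewrite det_mulmx det_up mul1r.
  rewrite -[B]submxK /up mulmx_block block_mxKul mul1mx -scalemxAl -rowE.
  apply/matrixP => k l; rewrite !ord1 !mxE /= divfK.
    by rewrite addrC subrK.
  by move: ci; rewrite /c !mxE.
have [c0|] := eqVneq (dlsubmx A) 0; last exact: corner.
have a0 : ulsubmx A 0 0 != 0.
  apply/eqP => a0; move/eqP: dA; rewrite -[A]submxK c0.
  rewrite det_ublock det_mx11 a0 mul0r eq_sym.
  by rewrite oner_eq0.
(* The first column vanishes below a nonzero corner. In size 1 the corner is the determinant;
   otherwise adding the first row to all others brings back the case [corner]. *)
case: m => [|m] in f fpos fM IH D2 D2U A dA det1U fup flo pivot1 corner c0 a0 *.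
  apply: pivot1 => //; move: dA; rewrite -{1}[A]submxK c0.
  by rewrite det_ublock det_mx00 mulr1 [X in \det X]mx11_scalar det_scalar1
    [X in _ -> X = _]mx11_scalar => ->.
have -> : f A = f (lo (const_mx 1) *m A).
  by rewrite fM ?det1U ?det_lo// flo mul1r.
apply: corner; first by rewrite det_mulmx det_lo mul1r.
rewrite -[A]submxK /lo mulmx_block block_mxKdl c0 mulmx0 addr0.
apply/eqP => /matrixP/(_ 0 0); rewrite !mxE big_ord1 !mxE mul1r.
by move/eqP: a0; rewrite !mxE.
Qed.

End unimodular.

(** * Symmetric matrices near a diagonal matrix of signs *)

Section diagonal.
Context {R : realType}.

(** The pivot keeps the sign of [e 0], and the Schur complement is again near the remaining signs.
    The error at most doubles at each step, whence the tolerance [2^-1 ^+ n.+1]. *)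
Lemma near_diag_congruent n (e : 'I_n -> R) (S : 'M[R]_n) :
  (forall i, e i = 1 \/ e i = -1) -> S^T = S ->
  (forall i j, `|S i j - e i *+ (i == j)| <= 2^-1 ^+ n.+1) ->
  exists2 g : 'M[R]_n, g \in unitmx & g *m S *m g^T = diag_mx (\row_i e i).
Proof.
elim: n e S => [|m IH] e S ePM Ssym near.
  by exists 1%:M; [exact: unitmx1|rewrite [LHS]flatmx0 [RHS]flatmx0].
move: e S ePM Ssym near; change m.+1 with (1 + m)%N => e S ePM Ssym near.
pose d : R := 2^-1 ^+ m.+2.
have d0 : 0 < d by rewrite exprn_gt0 ?invr_gt0.
have d4 : d <= 2^-1 ^+ 2 by apply: ler_wiXn2l => //; lra.
pose a := ulsubmx S 0 0; pose c := dlsubmx S; pose D := drsubmx S.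
have rE : ursubmx S = c^T by rewrite /c -[in RHS]Ssym trmx_dlsub trmxK.
have ne0 : `|a - e 0| <= d.
  have := near 0 0; rewrite eqxx mulr1n /a !mxE; congr (`|S _ _ - e 0| <= d); exact: val_inj.
have aabs : a = e 0 * `|a| /\ 2^-1 <= `|a|.
  have {}ne0 : `|a - e 0| <= 2^-1.
    by apply: le_trans ne0 (le_trans d4 _); rewrite expr2; lra.
  have := ePM 0; move: ne0; rewrite ler_norml => /andP[l1 l2] [] e1.
    have a0 : 0 < a by rewrite e1 in l1; lra.
    by rewrite e1 gtr0_norm// mul1r; split=> //; rewrite e1 in l1; lra.
  have a0 : a < 0 by rewrite e1 in l2; lra.
  by rewrite e1 ltr0_norm// mulN1r opprK; split=> //; rewrite e1 in l2; lra.
have [aE a2] := aabs.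
have a0 : 0 < `|a| by apply: lt_le_trans a2; rewrite invr_gt0.
have aN0 : a != 0 by rewrite -normr_gt0.
have cd i : `|c i 0| <= d.
  have := near (rshift 1 i) (lshift m 0).
  by rewrite eq_rlshift mulr0n subr0 /c !mxE.
pose S' := D - a^-1 *: (c *m c^T).
have [|||g' g'U g'E] := IH (fun i => e (rshift 1 i)) S'.
- by move=> i; exact: ePM.
- rewrite /S' linearB /= linearZ /= trmx_mul trmxK; congr (_ - _).
  by rewrite /D trmx_drsub Ssym.
- move=> i j.
  have -> : S' i j - e (rshift 1 i) *+ (i == j) =
      (D i j - e (rshift 1 i) *+ (i == j)) - a^-1 * (c i 0 * c j 0).
    by rewrite /S' !mxE big_ord1 !mxE addrAC.
  have D1 : `|D i j - e (rshift 1 i) *+ (i == j)| <= d.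
    by have := near (rshift 1 i) (rshift 1 j); rewrite eq_rshift /D !mxE.
  have D2 : `|a^-1 * (c i 0 * c j 0)| <= d.
    rewrite !normrM normfV -ler_pdivlMl ?invr_gt0// invrK.
    rewrite mulrC ler_pM//.
    apply: le_trans (cd j) (le_trans d4 (le_trans _ a2)).
    by rewrite expr2; lra.
  (* The block contributes d, and so does the Schur correction because d <= 1/4 < |a|; 2 d is
     exactly the tolerance in size m. *)
  apply: le_trans (ler_normB _ _) _; apply: le_trans (lerD D1 D2) _.
  have -> : d = 2^-1 * 2^-1 ^+ m.+1 by rewrite -exprS.
  lra.
pose s := (Num.sqrt `|a|)^-1.
have s0 : 0 < s by rewrite invr_gt0 sqrtr_gt0.
(* Eliminates the first column, scales the pivot to its sign by [s], and applies [g'] to the Schur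
   complement. *)
pose L : 'M[R]_(1 + m) := block_mx s%:M 0 (- a^-1 *: (g' *m c)) g'.
exists L.
  by rewrite unitmxE det_lblock det_scalar1 unitrM unitfE gt_eqF//= -unitmxE.
have SE : S = block_mx a%:M c^T c D.
  by rewrite -[LHS]submxK rE [ulsubmx S]mx11_scalar.
have K1 : - a^-1 *: (g' *m c) *m a%:M + g' *m c = 0.
  by rewrite mul_mx_scalar scalerA mulrN divff// scaleN1r addNr.
have K2 : - a^-1 *: (g' *m c) *m c^T + g' *m D = g' *m S'.
  rewrite /S' mulmxBr -scalemxAr addrC; congr (_ + _).
  by rewrite -scalemxAl -mulmxA scaleNr.
rewrite SE /L tr_block_mx !mulmx_block K1 K2 !mul0mx !addr0 trmx0.
rewrite !(mulmx0, mul0mx, addr0, add0r) g'E.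
have -> : s%:M *m a%:M *m (s%:M)^T = ((e 0)%:M : 'M[R]_1).
  rewrite tr_scalar_mx -!scalar_mxM; congr (_%:M).
  rewrite aE mulrAC mulrCA (_ : s * s * `|a| = 1) ?mulr1//.
  by rewrite /s -invfM -expr2 sqr_sqrtr// mulVf// gt_eqF.
have -> : s%:M *m a%:M *m (- a^-1 *: (g' *m c))^T + s%:M *m c^T *m g'^T = 0.
  rewrite -scalar_mxM mul_scalar_mx linearZ /= trmx_mul scalerA mul_scalar_mx.
  by rewrite -scalemxAl mulrN mulfK// scaleNr addNr.
apply/matrixP => i j; rewrite -(splitK i) -(splitK j).
case: (fintype.split i) => i'; case: (fintype.split j) => j' /=.
- rewrite block_mxEul !ord1 !mxE !eqxx; congr (e _ *+ _); exact: val_inj.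
- by rewrite block_mxEur !mxE eq_lrshift.
- by rewrite block_mxEdl !mxE eq_rlshift.
- by rewrite block_mxEdr !mxE eq_rshift.
Qed.

End diagonal.

(** * Gram matrices *)

Section gram.
Context {R : realType} (V : vectType R).
Local Notation n := (\dim {:V}).
Local Notation vb := (vbasis {:V}).
Implicit Types (b : Sigma V).

Definition comb (P : 'M[R]_n) (i : 'I_n) : V := \sum_k P i k *: vb`_k.

Definition coords (w : 'I_n -> V) : 'M[R]_n := \matrix_(i, k) coord vb k (w i).

Lemma coordsK w i : comb (coords w) i = w i.
Proof.
rewrite /comb [RHS](coord_vbasis (memvf (w i))).
by apply: eq_bigr => k _; rewrite mxE.
Qed.

Lemma coord_comb P i k : coord vb k (comb P i) = P i k.
Proof. by rewrite coord_sum_free// (basis_free (vbasisP _)). Qed.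

Lemma form_sumr b v (c : 'I_n -> R) (w : 'I_n -> V) :
  b v (\sum_k c k *: w k) = \sum_k c k * b v (w k).
Proof.
have bl a x y : b v (a *: x + y) = a * b v x + b v y.
  by have [+ _ _] := set_mem (valP b) => /(_ v a x y).
elim/big_rec2: _ => [|k y x _ <-]; last exact: bl.
by have := bl (-1) 0 0; rewrite scaler0 addr0 mulN1r addNr.
Qed.

Lemma form_sym b v w : b v w = b w v.
Proof. by have [_ _ bs] := set_mem (valP b); exact: bs. Qed.

Lemma form_suml b v (c : 'I_n -> R) (w : 'I_n -> V) :
  b (\sum_k c k *: w k) v = \sum_k c k * b (w k) v.
Proof.
by rewrite form_sym form_sumr; apply: eq_bigr => k _; rewrite form_sym.
Qed.

Lemma gram_comb b P i j :
  b (comb P i) (comb P j) = (P *m gram_matrix b *m P^T) i j.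
Proof.
rewrite /comb form_sumr mxE; apply: eq_bigr => k _.
rewrite form_suml !mxE mulrC; congr (_ * _).
by apply: eq_bigr => l _; rewrite mxE.
Qed.

Lemma gram_sym b : (gram_matrix b)^T = gram_matrix b.
Proof. by apply/matrixP => i j; rewrite !mxE form_sym. Qed.

Lemma gram_inj : injective (@gram_matrix R V).
Proof.
move=> b b' bb'; apply: val_inj; apply/funext => v; apply/funext => w.
change (b v w = b' v w).
rewrite (coord_vbasis (memvf v)) (coord_vbasis (memvf w)) !form_sumr.
apply: eq_bigr => k _; rewrite !form_suml; congr (_ * _).
apply: eq_bigr => l _; congr (_ * _).
by move/matrixP : bb' => /(_ l k); rewrite !mxE.
Qed.

Lemma gram_surj (S : 'M[R]_n) : S^T = S -> exists b, gram_matrix b = S.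
Proof.
move=> SS.
pose f v w : R := \sum_i \sum_j coord vb i v * coord vb j w * S i j.
have fS : f \in @symmetric_forms R V.
  have fsym v w : f v w = f w v.
    rewrite /f exchange_big /=; apply: eq_bigr => i _; apply: eq_bigr => j _.
    by rewrite [coord vb j v * _]mulrC -[in LHS]SS mxE.
  have fl v : scalar (f v).
    move=> a x y; rewrite /f mulr_sumr -big_split; apply: eq_bigr => i _ /=.
    rewrite mulr_sumr -big_split; apply: eq_bigr => j _ /=.
    by rewrite linearP /= mulrDr mulrDl; congr (_ + _); rewrite !mulrA [_ * a]mulrC.
  apply/mem_set; split=> // v a x y.
  by rewrite /= fsym (fl v) (fsym x) (fsym y).
exists (exist _ f fS); apply/matrixP => i j; rewrite mxE.
rewrite [LHS]/(f _ _) /f (bigD1 i)//= (bigD1 j)//= !coord_free ?(basis_free (vbasisP _))//.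
rewrite !eqxx !mul1r !big1 ?addr0// => [k ki|k kj].
  rewrite big1// => l _; rewrite coord_free ?(basis_free (vbasisP _))//.
  by rewrite eq_sym (negbTE ki) !mul0r.
by rewrite coord_free ?(basis_free (vbasisP _))// eq_sym (negbTE kj) mulr0 mul0r.
Qed.

(** The action goes through the inverse of g, so the rows of [P] are the coordinates of the images
    of the basis under that inverse. *)
Lemma gram_act (g : GL V) : exists2 P : 'M[R]_n, P \in unitmx &
  forall b, gram_matrix (act_form g b) = P *m gram_matrix b *m P^T.
Proof.
have gVK := lker0_lfunVK (GL_lker g).
pose w i := (val g)^-1%VF vb`_i.
exists (coords w).
  apply: (proj1 (mulmx1_unit (B := coords (fun i => val g vb`_i)) _)).
  apply/matrixP => i j; rewrite !mxE.
  transitivity (coord vb j (val g (comb (coords w) i))).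
    rewrite !linear_sum; apply: eq_bigr => k _; rewrite !linearZ /=.
    by congr (_ * _); rewrite mxE.
  by rewrite coordsK /w gVK coord_free// (basis_free (vbasisP _)).
move=> b; apply/matrixP => i j; rewrite -gram_comb !coordsK mxE.
by [].
Qed.

Lemma gram_act_surj (P : 'M[R]_n) : P \in unitmx ->
  exists g : GL V, forall b,
    gram_matrix (act_form g b) = P *m gram_matrix b *m P^T.
Proof.
move=> PU.
have lin (Q : 'M[R]_n) : exists f : 'End(V), forall i : 'I_n, f vb`_i = comb Q i.
  have [f fE] := linear_of_free vb [seq comb Q i | i <- enum 'I_n].
  exists (linfun f) => i; rewrite lfunE /=.
  rewrite -(nth_map 0 0) ?size_tuple// fE ?(basis_free (vbasisP _))//.
    by rewrite (nth_map i) ?size_enum_ord// nth_ord_enum.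
  by rewrite size_map size_enum_ord size_tuple.
have [h hE] := lin P; have [k kE] := lin (invmx P).
have cmp (f f' : 'End(V)) (Q Q' : 'M[R]_n) : (forall i : 'I_n, f vb`_i = comb Q i) ->
    (forall i : 'I_n, f' vb`_i = comb Q' i) -> Q *m Q' = 1%:M -> cancel f f'.
  move=> fE f'E QQ v; rewrite [in LHS](coord_vbasis (memvf v)) !linear_sum.
  rewrite [RHS](coord_vbasis (memvf v)); apply: eq_bigr => i _.
  rewrite !linearZ /= fE /comb linear_sum; congr (_ *: _).
  under eq_bigr do rewrite linearZ /= f'E /comb scaler_sumr.
  rewrite exchange_big /= (bigD1 i)//= [X in _ + X]big1 ?addr0.
    under eq_bigr do rewrite scalerA; rewrite -scaler_suml.
    by have := congr1 (fun M : 'M[R]_n => M i i) QQ; rewrite !mxE eqxx => ->; rewrite scale1r.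
  move=> j ji; under eq_bigr do rewrite scalerA; rewrite -scaler_suml.
  have := congr1 (fun M : 'M[R]_n => M i j) QQ; rewrite !mxE eq_sym (negbTE ji) => ->.
  by rewrite scale0r.
have hk := cmp _ _ _ _ hE kE (mulmxV PU).
have kh := cmp _ _ _ _ kE hE (mulVmx PU).
have kb : bijective k by exists h.
(* The group element is [k], built from [invmx P], because its inverse [h] must send the basis to
   the rows of [P]. *)
pose g : GL V := exist _ k (mem_set kb).
exists g => b.
have gV v : (val g)^-1%VF v = h v.
  by rewrite -{1}(hk v) (lker0_lfunK (GL_lker g)).
apply/matrixP => i j; rewrite -gram_comb mxE -!hE -!gV.
by [].
Qed.

Section signature.
Variables (p p' : nat) (hpp' : (p + p')%N = n).

Definition std_sign (i : 'I_n) : R := if (i < p)%N then 1 else -1.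
Definition std_diag : 'M[R]_n := diag_mx (\row_i std_sign i).

Let neq1N1 : (1 == -1 :> R) = false.
Proof. by apply/eqP; lra. Qed.

Lemma std_signP i : std_sign i = 1 \/ std_sign i = -1.
Proof. by rewrite /std_sign; case: ifP; [left|right]. Qed.

Lemma card_std_sign1 : #|[set i : 'I_n | std_sign i == 1]%SET| = p.
Proof.
have <- : #|[set i : 'I_n | (i < p)%N]%SET| = p.
  by rewrite -hpp' -sum1dep_card big_ord_narrow ?leq_addr // sum1_card card_ord.
apply: eq_card => i; rewrite !inE /std_sign.
by case: ifP; rewrite ?eqxx // eq_sym neq1N1.
Qed.

Lemma card_sign (e : 'I_n -> R) : (forall i, e i = 1 \/ e i = -1) ->
  (#|[set i | e i == 1%R]%SET| + #|[set i | e i == (-1)%R]%SET|)%N = n.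
Proof.
move=> eP; rewrite -[RHS]card_ord -(cardsC [set i | e i == 1]%SET).
congr addn; apply: eq_card => i; rewrite !inE.
by case: (eP i) => ->; rewrite ?eqxx ?neq1N1 // eq_sym neq1N1.
Qed.

Lemma card_std_signN1 : #|[set i : 'I_n | std_sign i == -1]%SET| = p'.
Proof.
have := etrans (card_sign std_signP) (esym hpp').
by rewrite card_std_sign1 => /addnI.
Qed.

Lemma sign_perm (e : 'I_n -> R) : (forall i, e i = 1 \/ e i = -1) ->
  #|[set i | e i == 1]%SET| = p ->
  exists s : 'S_n, forall i, e (s i) = std_sign i.
Proof.
move=> eP ep.
have eN : #|[set i | e i == -1]%SET| = p'.
  by have := etrans (card_sign eP) (esym hpp'); rewrite ep => /addnI.
(* Sign tuples have only two values, so two cardinals determine the count of any predicate, and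
   equal counts give a permutation. *)
have cnt (f : 'I_n -> R) (a : pred R) : (forall i, f i = 1 \/ f i = -1) ->
    count a [tuple f i | i < n] =
    (a 1%R * #|[set i | f i == 1%R]%SET| + a (-1)%R * #|[set i | f i == (-1)%R]%SET|)%N.
  move=> fP.
  have cE (x : R) : #|[set i | f i == x]%SET| = (\sum_i (f i == x))%N.
    by rewrite -sum1dep_card big_mkcond; apply: eq_bigr => i _; case: ifP.
  rewrite !cE !big_distrr -big_split -sum1_count big_map big_mkcond /=.
  rewrite big_enum /=; apply: eq_bigr => i _.
  case: (fP i) => -> /=; rewrite eqxx ?neq1N1 /=.
    by rewrite muln1 muln0 addn0; case: (a 1).
  by rewrite eq_sym neq1N1 muln1 muln0 add0n; case: (a _).
have /tuple_permP[s sE] : perm_eq [tuple std_sign i | i < n] [tuple e i | i < n].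
  by apply/seq.permP => a; rewrite !cnt// ?ep ?eN ?card_std_sign1
    ?card_std_signN1//; exact: std_signP.
exists s => i; move/val_inj: sE => /(congr1 (fun t => tnth t i)).
by rewrite !tnth_mktuple.
Qed.

(** Replaces the signature by congruence to one fixed matrix, from which transitivity and openness
    are read. The rows of [g] are the coordinates of an orthonormal basis in which the vectors of
    square 1 come first. *)
Lemma scalar_productsP b : scalar_products p p' b <->
  exists2 g : 'M[R]_n, g \in unitmx & g *m gram_matrix b *m g^T = std_diag.
Proof.
have sgnN0 j : std_sign j != 0.
  by case: (std_signP j) => ->; rewrite ?oppr_eq0 oner_eq0.
split=> [[_ [e [[be orth epm] ep ep']]]|[g gU gE]].
  have [s sE] := sign_perm epm ep.
  pose w i := e`_(s i).
  have wE : coords w *m gram_matrix b *m (coords w)^T = std_diag.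
    apply/matrixP => i j; rewrite -gram_comb !coordsK !mxE.
    have [<-|ij] := eqVneq i j; first by rewrite mulr1n sE.
    by rewrite mulr0n orth// (inj_eq perm_inj).
  exists (coords w) => //; rewrite unitmxE.
  have := congr1 (fun M => \det M) wE; rewrite !det_mulmx det_tr det_diag => dE.
  have : \prod_i (\row_i std_sign i : 'rV[R]_n) 0 i != 0.
    by apply/prodf_neq0 => i _; rewrite mxE sgnN0.
  by rewrite -dE !mulf_eq0 !negb_or unitfE => /andP[/andP[]].
have cE i j : b (comb g i) (comb g j) = std_sign i *+ (i == j).
  by rewrite gram_comb gE !mxE.
pose e : n.-tuple V := [tuple comb g i | i < n].
have eE (i : 'I_n) : e`_i = comb g i by rewrite -tnth_nth tnth_mktuple.
(* Pairing with [e] recovers coefficients up to sign; this gives both the freeness of [e] and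
   non-degeneracy. *)
have bej v (c : 'I_n -> R) (j : 'I_n) : v = \sum_i c i *: e`_i -> b v e`_j = c j * std_sign j.
  move=> ->; rewrite form_suml (bigD1 j)//= big1 ?addr0.
    by rewrite !eE cE eqxx mulr1n.
  by move=> i ij; rewrite !eE cE (negbTE ij) mulr0n mulr0.
have fe : free e.
  apply/freeP => c c0 j; have := bej 0 c j (esym c0).
  rewrite (_ : b 0 _ = 0).
    by move/esym/eqP; rewrite mulf_eq0 (negbTE (sgnN0 j)) orbF => /eqP.
  have := form_suml b e`_j (fun=> 0) (fun=> 0).
  by rewrite big1 => [->|? _]; rewrite ?scaler0 // big1// => ? _; rewrite mul0r.
have be : basis_of {:V} e by rewrite basisEfree fe subvf size_tuple leqnn.
split.
  move=> v vb0; rewrite (coord_basis be (memvf v)) big1// => j _.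
  have := bej v (fun j => coord e j v) j (coord_basis be (memvf v)).
  rewrite vb0 => /esym/eqP; rewrite mulf_eq0 (negbTE (sgnN0 j)) orbF => /eqP ->.
  by rewrite scale0r.
exists e; split.
- split=> // [i j ij|i]; first by rewrite !eE cE (negbTE ij).
  by rewrite eE cE eqxx; exact: std_signP.
- by rewrite -[RHS]card_std_sign1; apply: eq_card => i; rewrite !inE eE cE eqxx.
- by rewrite -[RHS]card_std_signN1; apply: eq_card => i; rewrite !inE eE cE eqxx.
Qed.

End signature.
End gram.

(** * Regularity of Borel measures *)

Section regularity.
Context {R : realType} (T : ptopologicalType).
Local Notation B := (borelType T).
Variable mu : {measure set B -> \bar R}.
Local Open Scope ereal_scope.

Lemma measure_bigcup_small (A : nat -> set B) (e : R) : (0 <= e)%R ->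
  (forall k, measurable (A k)) ->
  (forall k, mu (A k) <= (e / (2 ^ k.+1)%:R)%:E) ->
  mu (\bigcup_k A k) <= e%:E.
Proof.
move=> e0 mA Ae.
apply: (@le_trans _ _ (\sum_(0 <= k <oo) mu (A k))).
  by apply: measure_sigma_subadditive => //; exact: bigcupT_measurable.
apply: le_trans (epsilon_trick0 xpredT e0).
by apply: lee_nneseries => // k _; exact: Ae.
Qed.

Lemma borel_closed (A : set T) : closed A -> measurable (A : set B).
Proof.
move=> cA; rewrite -[A]setCK; apply: measurableC; apply: borel_open.
exact: closed_openC.
Qed.

Section finite_piece.
Variable O : set T.
Hypotheses (oO : open O) (muO : mu O < +oo).

(* Within O, the closed set ~` V approximates A from inside. *)
Definition small_cover (A : set B) := forall e : R, (0 < e)%R ->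
  exists V : set T, [/\ open V, ~` A `<=` V & mu (V `&` A `&` O) <= e%:E].

Let mO : measurable (O : set B). Proof. exact: borel_open. Qed.

(** An infinite intersection of the [V k] need not be open, so only the first m are intersected. The
    part [D m] of the union that they miss tends to measure 0 because [O] has finite measure. *)
Lemma small_cover_bigcup (A : nat -> set B) : (forall k, measurable (A k)) ->
  (forall k, small_cover (A k)) -> small_cover (\bigcup_k A k).
Proof.
move=> mA sA e e0.
have e20 : (0 < e / 2)%R by lra.
have /choice[V /all_and3[oV AV muV]] : forall k, exists V : set T,
    [/\ open V, ~` A k `<=` V &
      mu (V `&` A k `&` O) <= (e / 2 / (2 ^ k.+1)%:R)%:E].
  by move=> k; apply: sA; rewrite divr_gt0// ltr0n expn_gt0.
have mV k : measurable (V k : set B) by exact: borel_open.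
pose D m : set B := (\bigcup_k A k) `&` O `\` \bigcup_(k < m) A k.
have mD m : measurable (D m).
  apply: measurableD; last exact: bigcup_measurable.
  by apply: measurableI => //; exact: bigcupT_measurable.
have D0 : \bigcap_m D m = set0.
  rewrite -subset0 => x Dx; have [[[k _ Ak] _] _] := Dx 0%N I.
  by have [_] := Dx k.+1 I; apply; exists k => /=.
have [m muD] : exists m, mu (D m) <= (e / 2)%:E.
  have : mu \o D @ \oo --> 0.
    rewrite -[X in _ --> X](@measure0 _ _ _ mu) -D0.
    apply: nonincreasing_cvg_mu => //.
    - apply: le_lt_trans muO; apply: measure_mono => //.
      by move=> x [[]].
    - by rewrite D0.
    - move=> i j ij; apply/subsetPset => x [Ax nA]; split => //.
      by apply: contra_not nA => -[k /= ki Ak]; exists k => //=; exact: leq_trans ki ij.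
  move=> /(_ _ (@open_ereal_lt' _ 0 (e / 2)%:E _))[|m _ /(_ m (leqnn _)) Dm].
    by rewrite lte_fin.
  by exists m; exact: ltW.
have oVm : open (\bigcap_(k in `I_m) V k).
  rewrite -[X in open X]setCK; apply: closed_openC; rewrite setC_bigcap.
  by apply: closed_bigcup => // k _; exact: open_closedC.
exists (\bigcap_(k in `I_m) V k); split => //.
- move=> x nA k _; apply: AV => Ak; apply: nA; by exists k.
have -> : e = (e / 2 + e / 2)%R by lra.
rewrite EFinD.
apply: (@le_trans _ _ (mu ((\bigcup_k (V k `&` A k `&` O)) `|` D m))).
  apply: measure_mono.
  - apply: measurableI => //; apply: measurableI; last exact: bigcupT_measurable.
    exact: borel_open.
  - apply: measurableU => //; apply: bigcupT_measurable => k.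
    by apply: measurableI => //; exact: measurableI.
  - move=> x [[Vx Ax] Ox]; have [[k /= km Ak]|nA] := pselect ((\bigcup_(k < m) A k) x).
      by left; exists k => //; split => //; split => //; exact: Vx.
    by right.
apply: le_trans (measureU2 _ _ _) _ => //.
  apply: bigcupT_measurable => k.
  by apply: measurableI => //; exact: measurableI.
apply: leeD => //; apply: measure_bigcup_small => //; first exact: ltW.
by move=> k; apply: measurableI => //; exact: measurableI.
Qed.

Hypothesis open_closed : forall W : set T, open W ->
  exists2 K : nat -> set T, W = \bigcup_k K k & forall k, closed (K k).

Lemma small_cover_closed (A : set T) : closed A -> small_cover A.
Proof.
move=> cA e e0; exists (~` A); split => //; first exact: closed_openC.
by rewrite setICl set0I measure0 lee_fin ltW.
Qed.

(** Requiring the property of a set and of its complement yields a sigma-algebra. It contains the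
    open sets because they are countable unions of closed sets. *)
Lemma small_cover_borel : @measurable _ B `<=` small_cover.
Proof.
pose C : set (set B) := [set A | [/\ measurable A, small_cover A & small_cover (~` A)]].
suff sC : <<s @open T >> `<=` C by move=> A /sC[].
apply: smallest_sub => [|W oW]; last first.
  split; first exact: borel_open.
    have [K -> cK] := open_closed oW.
    by apply: small_cover_bigcup => k; [exact: borel_closed|exact: small_cover_closed].
  by apply: small_cover_closed; exact: open_closedC.
split.
- split => //; first by apply: small_cover_closed; exact: closed0.
  by rewrite setC0; apply: small_cover_closed; exact: closedT.
- move=> A [mA sA sCA]; rewrite setTD; split => //; first exact: measurableC.
  by rewrite setCK.
- move=> A AC; have mA k : measurable (A k : set B) by have [] := AC k.
  split; first exact: bigcupT_measurable.
    by apply: small_cover_bigcup => // k; have [] := AC k.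
  move=> e e0; have /choice[V /all_and3[oV AV muV]] : forall k, exists V : set T,
    [/\ open V, A k `<=` V & mu (V `&` ~` A k `&` O) <= (e / (2 ^ k.+1)%:R)%:E].
    move=> k; have [_ _ sCA] := AC k.
    have [|V [oV AV muV]] := sCA (e / (2 ^ k.+1)%:R)%R; last first.
      by exists V; split => //; rewrite -[A k]setCK.
    by rewrite divr_gt0// ltr0n expn_gt0.
  have mV k : measurable (V k `&` ~` A k `&` O : set B).
    apply: measurableI => //; apply: measurableI; first exact: borel_open.
    exact: measurableC.
  exists (\bigcup_k V k); split; first exact: bigcup_open.
    by rewrite setCK; apply: subset_bigcup => k _; exact: AV.
  apply: le_trans (measure_bigcup_small (ltW e0) mV muV).
  apply: measure_mono; last 1 first.
  - move=> x [[[k _ Vx] nA] Ox]; exists k => //; split => //; split => //.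
    by apply: contra_not nA => Ax; exists k.
  - apply: measurableI => //; apply: measurableI; last first.
      by apply: measurableC; exact: bigcupT_measurable.
    by apply: bigcupT_measurable => k; exact: borel_open.
  - exact: bigcupT_measurable.
Qed.

End finite_piece.

Hypothesis hT : hausdorff_space T.
Hypothesis open_sigma_compact : forall W : set T, open W ->
  exists2 K : nat -> set T, W = \bigcup_k K k & forall k, compact (K k).
Variable O : nat -> set T.
Hypothesis oO : forall k, open (O k).
Hypothesis coverO : \bigcup_k O k = setT.
Hypothesis muO : forall k, mu (O k) < +oo.

(** Finiteness on compact sets comes from finite subcovers, outer regularity from
    [small_cover_borel] on each [O k], inner regularity from sigma-compactness of open sets. *)
Lemma regular_of_open_cover : regular_measure mu.
Proof.
have oc (W : set T) : open W ->
    exists2 K : nat -> set T, W = \bigcup_k K k & forall k, closed (K k).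
  move=> /open_sigma_compact[K -> cK]; exists K => // k.
  exact: compact_closed (cK k).
have mO k : measurable (O k : set B) by exact: borel_open.
split.
- move=> K cK; have mK : measurable (K : set B).
    by apply: borel_closed; exact: compact_closed.
  move: cK; rewrite compact_cover => /(_ nat setT O)[//||D _ KD].
    by move=> x _; rewrite /cover coverO.
  apply: (@le_lt_trans _ _ (mu (\big[setU/set0]_(k <- finmap.enum_fset D) O k))).
    apply: measure_mono => //; first exact: bigsetU_measurable.
    by apply: subset_trans KD _; rewrite /cover bigcup_seq.
  elim: (finmap.enum_fset D) => [|k s IH]; first by rewrite big_nil measure0.
  rewrite big_cons; apply: le_lt_trans (measureU2 _ _ _) _ => //.
    exact: bigsetU_measurable.
  by apply: lte_add_pinfty; [exact: muO|exact: IH].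
- move=> A mA; apply/eqP; rewrite eq_le; apply/andP; split.
    apply: le_ereal_inf_tmp => _ [U [oU AU] <-]; apply: measure_mono => //.
    exact: borel_open.
  apply/lee_addgt0Pr => e e0.
  have /choice[V /all_and3[oV AV muV]] : forall k, exists V : set T,
      [/\ open V, A `<=` V & mu (V `&` ~` A `&` O k) <= (e / (2 ^ k.+1)%:R)%:E].
    move=> k; have := small_cover_borel (oO k) (muO k) oc (measurableC mA).
    move=> /(_ (e / (2 ^ k.+1)%:R)%R)[|V [oV AV muV]].
      by rewrite divr_gt0// ltr0n expn_gt0.
    by exists V; split => //; rewrite -[A]setCK.
  (* Cutting [V k] down to [O k] keeps its excess over A below e / 2^(k+1); the union still contains
     A since the [O k] cover. *)
  pose U : set T := \bigcup_k (V k `&` O k).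
  have oU : open U by apply: bigcup_open => k _; exact: openI.
  have mD k : measurable (V k `&` ~` A `&` O k : set B).
    apply: measurableI => //; apply: measurableI; first exact: borel_open.
    exact: measurableC.
  apply: (@le_trans _ _ (mu U)).
    apply: ereal_inf_lbound; exists U => //; split => // x Ax.
    have [k _ Ok] : (\bigcup_k O k) x by rewrite coverO.
    by exists k => //; split => //; exact: AV.
  apply: (@le_trans _ _ (mu (A `|` \bigcup_k (V k `&` ~` A `&` O k)))).
    apply: measure_mono; first exact: borel_open.
      by apply: measurableU => //; exact: bigcupT_measurable.
    move=> x [k _ [Vx Ox]]; have [Ax|nA] := pselect (A x); [by left|right].
    by exists k.
  apply: le_trans (measureU2 _ _ _) _ => //; first exact: bigcupT_measurable.
  by apply: leeD => //; apply: measure_bigcup_small => //; exact: ltW.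
- move=> U oU; have [K UK cK] := open_sigma_compact oU.
  have mK k : measurable (K k : set B) by apply: borel_closed; exact: compact_closed.
  pose L k : set T := \big[setU/set0]_(i < k.+1) K i.
  have mL k : measurable (L k : set B) by exact: bigsetU_measurable.
  have UL : U = \bigcup_k L k by rewrite UK -bigcup_bigsetU_bigcup.
  apply/eqP; rewrite eq_le; apply/andP; split; last first.
    apply: ge_ereal_sup => _ [C [cC CU] <-]; apply: measure_mono => //.
      by apply: borel_closed; exact: compact_closed.
    exact: borel_open.
  have : (mu \o L : nat -> \bar R) @ \oo --> mu U.
    rewrite UL; apply: nondecreasing_cvg_mu => //.
      exact: bigcupT_measurable.
    by move=> i j ij; apply/subsetPset; exact: subset_bigsetU.
  move=> cU; rewrite -(cvg_lim _ cU)//; apply: lime_le; first exact: cvgP cU.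
  apply: nearW => k; apply: ereal_sup_ubound; exists (L k) => //; split.
    by apply: bigsetU_compact.
  by rewrite UL; exact: bigcup_sup.
Qed.

End regularity.

(** * Spaces homeomorphic to an open set of row vectors *)

Section chart.
Context {R : realType} (T : ptopologicalType) (N : nat).
Local Notation B := (borelType T).
Variable kappa : T -> 'rV[R]_N.
Hypothesis kappa_inj : injective kappa.
Hypothesis kappa_open : forall A : set T,
  open A <-> exists2 W, open W & A = kappa @^-1` W.
Hypothesis kappa_range : open (range kappa).

Lemma chart_continuous : continuous kappa.
Proof. by apply/continuousP => W oW; apply/kappa_open; exists W. Qed.

Lemma chart_hausdorff : hausdorff_space T.
Proof.
rewrite open_hausdorff => x y xy.
have kxy : kappa x != kappa y by rewrite (inj_eq kappa_inj).
have := @norm_hausdorff R 'rV[R]_N; rewrite open_hausdorff.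
move=> /(_ _ _ kxy)[[U W]] /= [xU yW] [oU oW UW0].
exists (kappa @^-1` U, kappa @^-1` W) => /=.
  by split; rewrite inE /=; [rewrite inE in xU|rewrite inE in yW].
split; [by apply/kappa_open; exists U|by apply/kappa_open; exists W|].
by rewrite -preimage_setI (eqP UW0) preimage_set0.
Qed.

Lemma compact_closed_cube (c : 'rV[R]_N) r : compact (closed_cube c r).
Proof.
have := @rV_compact R N (fun i => `[c 0 i - r, c 0 i + r]%classic)
  (fun i => @segment_compact R _ _).
congr compact; apply/seteqP; split=> x /= xr.
  by move=> i j; rewrite !ord1 ler_distl; have := xr j; rewrite in_itv.
by move=> i; rewrite in_itv /= -ler_distl; exact: xr.
Qed.

(** The preimage is the image of Q under the inverse chart [j], which is continuous at points of the
    open range. *)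
Lemma chart_compact (Q : set 'rV[R]_N) : compact Q -> Q `<=` range kappa ->
  compact (kappa @^-1` Q).
Proof.
move=> cQ QE.
pose j y := xget point [set x | kappa x = y].
have jK y : range kappa y -> kappa (j y) = y.
  by move=> [x _ xy]; rewrite /j; case: xgetP => [z -> //|/(_ x)].
have kK x : j (kappa x) = x by apply: kappa_inj; rewrite jK//; exists x.
have -> : kappa @^-1` Q = j @` Q.
  apply/seteqP; split=> [x Qx|_ [y Qy <-]]; first by exists (kappa x).
  by rewrite /= jK//; exact: QE.
apply: continuous_compact => //; apply: continuous_in_subspaceT => y.
rewrite inE => /QE Ey A /=; rewrite nbhsE => -[U [oU Uy] UA].
have /kappa_open[W oW UW] := oU.
have : nbhs y (W `&` range kappa).
  apply: open_nbhs_nbhs; split; first exact: openI.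
  by split=> //; move: Uy; rewrite UW /= jK.
by apply: filterS => z [Wz Ez]; apply: UA; rewrite UW /= jK.
Qed.

(** Intersecting with the open range before choosing cubes keeps the closed cubes where their
    preimages are compact. *)
Lemma chart_open_cubes (A : set T) : open A ->
  exists (c : nat -> 'rV[R]_N) (r : nat -> R) (P : set nat),
    A = \bigcup_(k in P) kappa @^-1` ball (c k) (r k) /\
    forall k, P k -> [/\ 0 < r k, kappa @^-1` closed_cube (c k) (r k) `<=` A &
      closed_cube (c k) (r k) `<=` range kappa].
Proof.
move=> /kappa_open[W oW ->].
have [c [r [P [WE rP]]]] := open_cubes (openI oW kappa_range).
exists c, r, P; split.
  rewrite -preimage_bigcup -WE.
  by apply/seteqP; split=> x /=; [move=> Wx; split=> //; exists x|case].
move=> k /rP[r0 cW]; split=> // [x /cW[]|x /cW[]] //.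
Qed.

Lemma ball_closed_cube (c : 'rV[R]_N) r : ball c r `<=` closed_cube c r.
Proof. by move=> y [_ yr] i j; rewrite distrC; exact: ltW (yr i j). Qed.

Lemma chart_sigma_compact (A : set T) : open A ->
  exists2 K : nat -> set T, A = \bigcup_k K k & forall k, compact (K k).
Proof.
move=> /chart_open_cubes[c [r [P [AE rP]]]].
exists (fun k => if `[< P k >] then kappa @^-1` closed_cube (c k) (r k) else set0).
  apply/seteqP; split=> x.
    rewrite {1}AE => -[k Pk xk]; exists k => //; rewrite ifT; last exact/asboolP.
    exact: ball_closed_cube.
  by move=> [k _]; case: asboolP => // /rP[_ + _]; exact.
move=> k; case: asboolP => [/rP[_ _ cE]|_]; last exact: compact0.
by apply: chart_compact => //; exact: compact_closed_cube.
Qed.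

Lemma chart_sigma_finite (mu : {measure set B -> \bar R}) :
  regular_measure mu -> sigma_finite setT mu.
Proof.
move=> [muK _ _]; have [K KT cK] := chart_sigma_compact openT.
exists K => // k; split; last exact: muK.
by apply: borel_closed; apply: compact_closed (cK k); exact: chart_hausdorff.
Qed.

(* As k grows, min(1, k f) increases to the indicator of [set x | 0 < f x], so
   that measures with the same integrals of functions with compact support agree
   on these sets. *)
Definition test_sets : set (set B) := [set A | exists f : T -> R,
  [/\ continuous f, compactly_supported f, forall x, 0 <= f x &
    A = [set x | 0 < f x]]].

Lemma compactly_supported_sub (f g : T -> R) :
  compactly_supported f -> (forall x, f x = 0 -> g x = 0) ->
  compactly_supported g.
Proof.
move=> cf fg; apply: subclosed_compact (@closed_closure _ _) cf _.
apply: closure_subset => x /=.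
by apply: contra_neq; exact: fg.
Qed.

(** The test function is a tent over the ball; its support is compact because the closed cube lies
    in the range. *)
Lemma test_sets_ball (c : 'rV[R]_N) r : 0 < r ->
  closed_cube c r `<=` range kappa -> test_sets (kappa @^-1` ball c r).
Proof.
move=> r0 cE; exists (fun x => Num.max 0 (r - `|c - kappa x|)).
have kc := chart_continuous.
split.
- move=> x; apply: (@continuous_max R T (cst 0) (fun x => r - `|c - kappa x|)).
    exact: cst_continuous.
  apply: cvgB; first exact: cvg_cst.
  apply: cvg_norm; apply: cvgB; first exact: cvg_cst.
  exact: kc.
- have cQ : compact (kappa @^-1` closed_cube c r).
    by apply: chart_compact => //; exact: compact_closed_cube.
  have clQ : closed (kappa @^-1` closed_cube c r).
    exact: (compact_closed chart_hausdorff cQ).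
  apply: subclosed_compact (@closed_closure _ _) cQ _.
  rewrite [X in _ `<=` X](iffLR (closure_id _) clQ).
  apply: closure_subset => x /= fx; apply: ball_closed_cube.
  rewrite mx_norm_ball /ball_ /= ltNge; apply: contra fx => rx.
  by rewrite max_l// subr_le0.
- by move=> x; rewrite le_max lexx.
- apply/seteqP; split=> x /=; rewrite mx_norm_ball /ball_ /= lt_max ltxx /=.
    by rewrite subr_gt0.
  by rewrite subr_gt0.
Qed.

Lemma test_sets_setI : setI_closed test_sets.
Proof.
move=> _ _ [f [cf kf f0 ->]] [g [cg kg g0 ->]].
exists (fun x => Num.min (f x) (g x)); split.
- by move=> x; apply: continuous_min; [exact: cf|exact: cg].
- by apply: compactly_supported_sub kf _ => x ->; rewrite min_l.
- by move=> x; rewrite le_min f0 g0.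
- by apply/seteqP; split=> x /=; rewrite lt_min => /andP.
Qed.

Lemma test_sets_open A : test_sets A -> open (A : set T).
Proof.
move=> [f [cf _ _ ->]].
have -> : [set x | 0 < f x] = f @^-1` `]0, +oo[%classic.
  by apply/seteqP; split=> x /=; rewrite in_itv /= andbT.
by move/continuousP : cf; apply; exact: interval_open.
Qed.

Lemma borel_test_sets : @measurable _ B = <<s test_sets >>.
Proof.
apply/seteqP; split; apply: smallest_sub.
- exact: smallest_sigma_algebra.
- move=> A /chart_open_cubes[c [r [P [-> rP]]]].
  apply: (@bigcup_measurable _ (g_sigma_algebraType test_sets)) => k /rP[r0 _ cE].
  by apply: sub_sigma_algebra; exact: test_sets_ball.
- exact: smallest_sigma_algebra.
- by move=> A /test_sets_open; exact: sub_sigma_algebra.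
Qed.

Lemma measure_test_set (mu : {measure set B -> \bar R}) (f : T -> R) :
  continuous f -> (forall x, 0 <= f x) ->
  (fun k => \int[mu]_x (Num.min 1 (k%:R * f x))%:E)%E @ \oo --> mu [set x | 0 < f x].
Proof.
move=> cf f0.
have mf : measurable_fun setT (f : B -> R) by exact: continuous_borel_real.
have mg k : measurable_fun setT (fun x : B => (Num.min 1 (k%:R * f x))%:E).
  apply/measurable_EFinP; apply: measurable_minr => //.
  exact: measurable_funM.
have -> : mu [set x | 0 < f x] =
    (\int[mu]_x (\1_([set x | 0 < f x] : set B) x)%:E)%E.
  rewrite integral_indic ?setIT//; apply: borel_open.
  have -> : [set x | 0 < f x] = f @^-1` `]0, +oo[%classic.
    by apply/seteqP; split=> x /=; rewrite in_itv /= andbT.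
  by move/continuousP : cf; apply; exact: interval_open.
have gcv (x : T) : (fun k => (Num.min 1 (k%:R * f x))%:E) @ \oo -->
    (\1_([set x | 0 < f x] : set B) x)%:E.
  (* Each pointwise sequence is eventually constant: 1 once k exceeds the inverse of [f x], and 0
     where f vanishes. *)
  apply: cvg_near_cst; rewrite indicE; have [fx|fx] := ltP 0 (f x).
    rewrite mem_set//; exists (Num.truncn (f x)^-1).+1 => // k /= fk.
    rewrite min_l// -ler_pdivrMr// div1r; apply: le_trans (ltW (truncnS_gt _)) _.
    by rewrite ler_nat.
  have fx0 : f x = 0 by apply/eqP; rewrite eq_le fx f0.
  rewrite memNset /=; last by rewrite fx0 ltxx.
  by apply: nearW => k; rewrite fx0 mulr0 min_r.
rewrite (eq_integral (fun x : B => limn (fun k => (Num.min 1 (k%:R * f x))%:E))); last first.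
  by move=> x _; apply/esym/cvg_lim => //; exact: gcv.
apply: cvg_monotone_convergence => //.
- by move=> k x _; rewrite lee_fin le_min ler01 mulr_ge0.
- move=> x _ i j ij; rewrite lee_fin le_min ge_min lexx /=.
  by rewrite ge_min ler_wpM2r ?orbT// ler_nat.
Qed.

(** The two measures agree on the test sets, which are stable under intersection and generate the
    Borel sets. *)
Lemma pushforward_invariant (mu : {measure set B -> \bar R}) (phi : T -> T) :
  regular_measure mu -> continuous phi -> is_pushforward phi mu mu ->
  forall A : set B, measurable A -> mu (phi @^-1` A) = mu A.
Proof.
move=> rmu cphi [_ inv] A mA.
have mphi : measurable_fun setT (phi : B -> B) by exact: continuous_borel.
have [nu nuE] := pushforward_package mu mphi.
have [c [r [P [TE rP]]]] := chart_open_cubes openT.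
pose g k := if `[< P k >] then kappa @^-1` ball (c k) (r k) else set0.
have gt k : test_sets (g k).
  rewrite /g; case: asboolP => [/rP[r0 _ cE]|_]; first exact: test_sets_ball.
  exists (fun=> 0); split => //; first exact: cst_continuous.
    rewrite /compactly_supported (_ : [set x | _] = set0) ?closure0; first exact: compact0.
    by rewrite -subset0 => x /=; rewrite eqxx.
  by apply/esym; rewrite -subset0 => x /=; rewrite ltxx.
rewrite -[LHS]nuE; apply/esym.
apply: (measure_unique test_sets g borel_test_sets test_sets_setI gt _ mu nu) => //.
- apply/seteqP; split=> // x _.
  have [k Pk xk] : (\bigcup_(k in P) kappa @^-1` ball (c k) (r k)) x by rewrite -TE.
  by exists k => //; rewrite /g ifT//; exact/asboolP.
- move=> _ [f [cf kf f0 ->]].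
  have L1 := measure_test_set (mu := mu) cf f0.
  have L2 := measure_test_set (mu := mu) (f := f \o phi)
    (fun x => continuous_comp (cphi x) (cf (phi x))) (fun x => f0 (phi x)).
  rewrite nuE; apply: (cvg_unique (@ereal_hausdorff R) L1).
  apply: cvg_trans L2; apply: near_eq_cvg; apply: nearW => k /=.
  apply/esym/(inv (fun x => Num.min 1 (k%:R * f x))).
    move=> x; apply: (@continuous_min R T (cst 1) (fun x => k%:R * f x)).
      exact: cst_continuous.
    by apply: cvgM; [exact: cvg_cst|exact: cf].
  apply: compactly_supported_sub kf _ => x ->.
  by rewrite mulr0 min_r.
- move=> k; have [f [_ kf _ gE]] := gt k.
  have [muK _ _] := rmu; apply: le_lt_trans (muK _ kf); apply: measure_mono.
  + by apply: borel_open; exact: test_sets_open.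
  + by apply: borel_closed; exact: closed_closure.
  + apply: subset_trans (@subset_closure _ _); rewrite gE => x /=.
    by rewrite lt0r => /andP[].
Qed.

End chart.

(** * Coordinates on symmetric matrices *)

Section continuity.
Context {R : realType}.

Lemma continuous_sum (T : topologicalType) (I : Type) (r : seq I)
    (F : I -> T -> R) : (forall k, continuous (F k)) ->
  continuous (fun x => \sum_(k <- r) F k x).
Proof.
move=> cF x; apply: (@cvg_big _ _ +%R) => [|k _]; last exact: cF.
exact: add_continuous.
Qed.

Lemma continuous_prod (T : topologicalType) (I : Type) (r : seq I)
    (F : I -> T -> R) : (forall k, continuous (F k)) ->
  continuous (fun x => \prod_(k <- r) F k x).
Proof.
move=> cF x; apply: (@cvg_big _ _ (@GRing.mul R)) => [|k _]; last exact: cF.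
exact: mul_continuous.
Qed.

Lemma continuous_mx (T : topologicalType) m n (f : T -> 'M[R]_(m, n)) :
  (forall i j, continuous (fun x => f x i j)) -> continuous f.
Proof.
move=> cf x A /nbhs_ballP[e /= e0 eA]; apply: filterS eA _.
have : \forall y \near x, forall i j, ball (f x i j) e (f y i j).
  apply: filter_forall => i; apply: filter_forall => j.
  by have := cf i j x; move/(_ (ball (f x i j) e)); apply; exact: nbhsx_ballx.
by apply: filterS => y h; split.
Qed.

Lemma continuous_linear_mx m n m' n' (f : {linear 'M[R]_(m, n) -> 'M[R]_(m', n')}) :
  continuous f.
Proof.
apply: continuous_mx => i j.
rewrite (_ : (fun M => f M i j) =
  (fun M : 'M[R]_(m, n) => \sum_k \sum_l M k l * f (delta_mx k l) i j)).
  apply: continuous_sum => k; apply: continuous_sum => l x.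
  apply: (@continuousM R _ (fun M : 'M[R]_(m, n) => M k l) (cst _)).
    exact: coord_continuous.
  exact: cst_continuous.
apply/funext => M; rewrite [in LHS](matrix_sum_delta M) linear_sum summxE.
apply: eq_bigr => k _; rewrite linear_sum summxE; apply: eq_bigr => l _.
by rewrite linearZ mxE.
Qed.

Lemma continuous_det n : continuous (fun M : 'M[R]_n => \det M).
Proof.
rewrite /determinant; apply: continuous_sum => s x.
apply: (@continuousM R _ (cst _) (fun M : 'M[R]_n => \prod_i M i (s i))).
  exact: cst_continuous.
apply: (@continuous_prod _ _ _ (fun i (M : 'M[R]_n) => M i (s i))) => i.
exact: coord_continuous.
Qed.

Lemma continuous_vec_mx m n : continuous (fun t : 'rV[R]_(m * n) => vec_mx t).
Proof.
apply: continuous_mx => i j; under eq_fun do rewrite mxE.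
exact: coord_continuous.
Qed.

Lemma measurable_mulmx d (T : measurableType d) m n p
    (f : T -> 'M[R]_(m, n)) (g : T -> 'M[R]_(n, p)) :
  measurable_fun setT (f : T -> borelType 'M[R]_(m, n)) ->
  measurable_fun setT (g : T -> borelType 'M[R]_(n, p)) ->
  measurable_fun setT (fun x => f x *m g x : borelType 'M[R]_(m, p)).
Proof.
move=> mf mg; apply: measurable_mx => i j; under eq_fun do rewrite mxE.
apply: measurable_sum => k; apply: measurable_funM.
  exact: (measurableT_comp (measurable_coord i k) mf).
exact: (measurableT_comp (measurable_coord k j) mg).
Qed.

Lemma measurable_trmx d (T : measurableType d) m n (f : T -> 'M[R]_(m, n)) :
  measurable_fun setT (f : T -> borelType 'M[R]_(m, n)) ->
  measurable_fun setT (fun x => (f x)^T : borelType 'M[R]_(n, m)).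
Proof.
move=> mf; apply: measurable_mx => i j; under eq_fun do rewrite mxE.
exact: (measurableT_comp (measurable_coord j i) mf).
Qed.

End continuity.

Section symmetric_coordinates.
Context {R : realType} {n : nat}.

(** As a fixed space, symmetric matrices inherit a basis and a dimension from the theory of
    subspaces. *)
Definition symU : {vspace 'M[R]_n} := fixedSpace (linfun (@trmx R n n)).
Local Notation N := (\dim symU).
Local Notation X := (vbasis symU).

Definition sym_mx (r : 'rV[R]_N) : 'M[R]_n := \sum_k r 0 k *: X`_k.
Definition sym_coord (S : 'M[R]_n) : 'rV[R]_N := \row_k coord X k S.

Lemma symUP (S : 'M[R]_n) : (S \in symU) = (S^T == S).
Proof. by apply/fixedSpaceP/eqP; rewrite lfunE. Qed.

Lemma sym_mx_linear : linear sym_mx.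
Proof.
move=> a r s; rewrite /sym_mx scaler_sumr -big_split; apply: eq_bigr => k _ /=.
by rewrite !mxE scalerDl scalerA.
Qed.
HB.instance Definition _ := GRing.isLinear.Build R _ _ _ sym_mx sym_mx_linear.

Lemma sym_coord_linear : linear sym_coord.
Proof. by move=> a S S'; apply/rowP => k; rewrite !mxE linearP. Qed.
HB.instance Definition _ := GRing.isLinear.Build R _ _ _ sym_coord sym_coord_linear.

Lemma sym_mx_sym r : (sym_mx r)^T = sym_mx r.
Proof.
apply/eqP; rewrite -symUP memv_suml// => k _; apply: memvZ.
by apply: vbasis_mem; rewrite mem_nth// size_tuple.
Qed.

Lemma sym_mxK : cancel sym_mx sym_coord.
Proof.
move=> r; apply/rowP => k.
by rewrite mxE coord_sum_free// (basis_free (vbasisP _)).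
Qed.

Lemma sym_coordK S : S^T = S -> sym_mx (sym_coord S) = S.
Proof.
move=> /eqP; rewrite -symUP => SU; rewrite [RHS](coord_vbasis SU).
by apply: eq_bigr => k _; rewrite mxE.
Qed.

End symmetric_coordinates.

(** * The Gram matrix chart of Gamma *)

Section gamma_chart.
Context {R : realType} (V : vectType R) (p p' : nat).
Hypothesis hpp' : (p + p')%N = \dim {:V}.
Local Notation n := (\dim {:V}).
Local Notation G := (Gamma hpp').
Local Notation N := (\dim (@symU R n)).

Definition gamma_gram (x : G) : 'M[R]_n := gram_matrix (val x).
Definition gamma_coord (x : G) : 'rV[R]_N := sym_coord (gamma_gram x).

Lemma gamma_gram_sym x : (gamma_gram x)^T = gamma_gram x.
Proof. exact: gram_sym. Qed.

Lemma gamma_coordK x : sym_mx (gamma_coord x) = gamma_gram x.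
Proof. exact/sym_coordK/gamma_gram_sym. Qed.

Lemma gamma_gram_inj : injective gamma_gram.
Proof. by move=> x y /gram_inj/val_inj. Qed.

Lemma gamma_coord_inj : injective gamma_coord.
Proof.
by move=> x y xy; apply: gamma_gram_inj; rewrite -!gamma_coordK xy.
Qed.

Lemma gamma_gram_std x : exists2 g : 'M[R]_n, g \in unitmx &
  g *m gamma_gram x *m g^T = std_diag V p.
Proof. exact/(scalar_productsP hpp')/(set_mem (valP x)). Qed.

Lemma gamma_gram_surj (g S : 'M[R]_n) : S^T = S -> g \in unitmx ->
  g *m S *m g^T = std_diag V p -> exists x, gamma_gram x = S.
Proof.
move=> /gram_surj[b <-] gU gE.
have bG : scalar_products p p' b by apply/(scalar_productsP hpp'); exists g.
by exists (exist _ b (mem_set bG)).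
Qed.

Lemma gamma_open_gram (A : set G) :
  open A <-> exists2 W : set 'M[R]_n, open W & A = gamma_gram @^-1` W.
Proof.
split=> [[_ [W oW <-] <-]|[W oW ->]]; first by exists W.
by exists (@gram_matrix R V @^-1` W) => //; exists W.
Qed.

Lemma gamma_open_coord (A : set G) :
  open A <-> exists2 W : set 'rV[R]_N, open W & A = gamma_coord @^-1` W.
Proof.
split=> [/gamma_open_gram[W oW ->]|[W oW ->]].
  exists (sym_mx @^-1` W).
    by have /continuousP := @continuous_linear_mx R 1 N n n sym_mx; exact.
  by apply/seteqP; split=> x /=; rewrite gamma_coordK.
apply/gamma_open_gram; exists (sym_coord @^-1` W) => //.
by have /continuousP := @continuous_linear_mx R n n 1 N sym_coord; exact.
Qed.

(** Congruence by [g] moves the given point to [std_diag]; nearby symmetric matrices land within the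
    tolerance of [near_diag_congruent]. *)
Lemma gamma_coord_range : open (range gamma_coord).
Proof.
rewrite openE => _ [x _ <-].
have [g gU gE] := gamma_gram_std x.
pose F (r : 'rV[R]_N) := g *m sym_mx r *m g^T.
have cF : continuous F.
  have lF : linear F.
    by move=> a r s; rewrite /F linearP mulmxDr mulmxDl -scalemxAr -scalemxAl.
  pose FL := GRing.isLinear.Build R _ _ _ F lF.
  pose F' : {linear 'rV[R]_N -> 'M[R]_n} := HB.pack F FL.
  exact: (@continuous_linear_mx R 1 N n n F').
have e0 : 0 < 2^-1 ^+ n.+1 :> R by rewrite exprn_gt0// invr_gt0.
change (nbhs (gamma_coord x) (range gamma_coord)).
have FB : nbhs (gamma_coord x)
    (F @^-1` ball (F (gamma_coord x)) (2^-1 ^+ n.+1)).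
  exact: cF (nbhsx_ballx _ _ e0).
apply: filterS FB => r; rewrite /F /= gamma_coordK gE => -[_ Fr].
have [|||h hU hE] := @near_diag_congruent R n (@std_sign R V p) (F r).
- exact: std_signP.
- by rewrite /F !trmx_mul trmxK sym_mx_sym mulmxA.
- by move=> i j; rewrite distrC; have := Fr i j; rewrite !mxE; exact: ltW.
have [|||y yE] := @gamma_gram_surj (h *m g) (sym_mx r).
- exact: sym_mx_sym.
- by rewrite unitmx_mul hU.
- by rewrite -[RHS]hE /F trmx_mul !mulmxA.
by exists y => //; rewrite /gamma_coord yE sym_mxK.
Qed.

Lemma measurable_gamma_gram :
  measurable_fun setT (gamma_gram : borelType G -> borelType 'M[R]_n).
Proof.
apply: continuous_borel; apply/continuousP => W oW.
by apply/gamma_open_gram; exists W.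
Qed.

Lemma measurable_gamma d (T : measurableType d) (f : T -> G) :
  measurable_fun setT (fun t => gamma_gram (f t) : borelType 'M[R]_n) ->
  measurable_fun setT (f : T -> borelType G).
Proof.
move=> mf; apply: (@measurability _ _ T (borelType G) _ _ (@open G) erefl).
move=> _ [_ /gamma_open_gram[W oW ->] <-].
exact: (mf measurableT W (borel_open oW)).
Qed.

Lemma gamma_gram_act (g : GL V) : exists2 P : 'M[R]_n, P \in unitmx &
  forall x : G, gamma_gram (gbar g x) = P *m gamma_gram x *m P^T.
Proof. by have [P PU PE] := gram_act g; exists P => // x; exact: PE. Qed.

Lemma gamma_gram_act_surj (P : 'M[R]_n) : P \in unitmx -> exists g : GL V,
  forall x : G, gamma_gram (gbar g x) = P *m gamma_gram x *m P^T.
Proof. by move=> /gram_act_surj[g gE]; exists g => x; exact: gE. Qed.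

Lemma gbar_continuous (g : GL V) : continuous (gbar g : G -> G).
Proof.
have [P _ PE] := gamma_gram_act g.
apply/continuousP => _ /gamma_open_gram[W oW ->]; apply/gamma_open_gram.
exists ((mulmxr P^T \o mulmx P) @^-1` W); last first.
  by apply/seteqP; split=> x /=; rewrite PE.
by have /continuousP := @continuous_linear_mx R n n n n (mulmxr P^T \o mulmx P); exact.
Qed.

End gamma_chart.

(** * Uniqueness *)

Section gamma_uniqueness.
Context {R : realType}.

Context (V : vectType R) (p p' : nat).
Hypothesis hpp' : (p + p')%N = \dim {:V}.
Local Notation n := (\dim {:V}).
Local Notation G := (Gamma hpp').
Local Notation T := (borelType 'rV[R]_(n * n)).

(** Lets every vector of n * n entries act; the identity is a default on singular matrices, which
    the measure [phi] below ignores. *)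
Definition unit_part (t : T) : 'M[R]_n :=
  if \det (vec_mx t : 'M[R]_n) == 0 then 1%:M else vec_mx t.

Lemma unit_part_unit t : unit_part t \in unitmx.
Proof.
rewrite /unit_part; case: ifPn => [_|dt]; first exact: unitmx1.
by rewrite unitmxE unitfE.
Qed.

Lemma measurable_det_vec :
  measurable_fun setT (fun t : T => \det (vec_mx t : 'M[R]_n)).
Proof.
apply: continuous_borel_real => x.
apply: continuous_comp; first exact: continuous_vec_mx.
exact: continuous_det.
Qed.

Lemma measurable_unit_part :
  measurable_fun setT (unit_part : T -> borelType 'M[R]_n).
Proof.
apply: measurable_fun_ifT => //.
  apply: measurable_fun_eqr => //; exact: measurable_det_vec.
by apply: continuous_borel; exact: continuous_vec_mx.
Qed.

Lemma gamma_transitive (x y : G) : exists2 H : 'M[R]_n, H \in unitmx &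
  gamma_gram y = H *m gamma_gram x *m H^T.
Proof.
have [g gU gE] := gamma_gram_std x; have [h hU hE] := gamma_gram_std y.
exists (invmx h *m g); first by rewrite unitmx_mul unitmx_inv hU.
rewrite trmx_mul !mulmxA -(mulmxA (invmx h)) -(mulmxA (invmx h)) gE -hE.
by rewrite !mulmxA mulVmx// mul1mx -mulmxA -trmx_mul mulVmx// trmx1 mulmx1.
Qed.

Lemma invariant_measure_setI (mu : {measure set (borelType G) -> \bar R}) :
  invariant_measure mu -> forall (g : GL V) (A : set (borelType G)),
  measurable A -> mu (gbar g @^-1` A) = mu A.
Proof.
move=> [rmu inv] g A mA.
apply: (pushforward_invariant (@gamma_coord_inj _ _ _ _ hpp')
  (@gamma_open_coord _ _ _ _ hpp') (@gamma_coord_range _ _ _ _ hpp') rmu _ (inv g) mA).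
exact: gbar_continuous.
Qed.

Lemma nonzero_setT (mu : {measure set (borelType G) -> \bar R}) :
  nonzero_measure mu -> mu setT != 0.
Proof.
move=> [A mA]; apply: contra_neq => mu0.
by apply: (subset_measure0 mA _ _ mu0).
Qed.

Lemma gamma_measure_unique (mu nu : {measure set (borelType G) -> \bar R}) :
  nonzero_measure mu -> invariant_measure mu ->
  nonzero_measure nu -> invariant_measure nu ->
  exists2 c : R, 0 < c & forall A : set (borelType G), measurable A ->
    mu A = (c%:E * nu A)%E.
Proof.
move=> mu0 muI nu0 nuI.
have [lam lamL] := @lebesgue_exists R (n * n).
pose D : set T := [set t | \det (vec_mx t : 'M[R]_n) != 0].
have oD : open (D : set 'rV[R]_(n * n)).
  have /continuousP : continuous (fun t : 'rV[R]_(n * n) => \det (vec_mx t : 'M[R]_n)).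
    by move=> t; apply: continuous_comp; [exact: continuous_vec_mx|exact: continuous_det].
  by move=> /(_ [set x | x != 0]); apply; exact: open_neq.
have mD : measurable D by exact: borel_open.
have lamD0 : lam D != 0.
  apply: (lebesgue_open_neq0 (x := mxvec 1%:M) lamL oD).
  by rewrite /D /= mxvecK det1 oner_eq0.
have sfD : sigma_finite setT (mrestr lam mD).
  have [F TF FF] := lebesgue_sigma_finite lamL; exists F => // k.
  have [mF Foo] := FF k; split=> //; apply: le_lt_trans Foo.
  by apply: measure_mono => //; exact: measurableI.
have [phi phiE'] := sigma_finite_package sfD.
have phiE (S : set T) : phi S = lam (S `&` D) by exact: phiE'.
have /choice[gl glE] : forall t : T, exists g : GL V, forall x : G,
    gamma_gram (gbar g x) = unit_part t *m gamma_gram x *m (unit_part t)^T.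
  by move=> t; apply: gamma_gram_act_surj; exact: unit_part_unit.
have /choice[gl' gl'E] : forall t : T, exists g : GL V, forall x : G,
    gamma_gram (gbar g x) = invmx (unit_part t) *m gamma_gram x *m (invmx (unit_part t))^T.
  by move=> t; apply: gamma_gram_act_surj; rewrite unitmx_inv unit_part_unit.
pose a t (x : borelType G) : borelType G := gbar (gl t) x.
pose b t (x : borelType G) : borelType G := gbar (gl' t) x.
have ma : measurable_fun setT (fun z : T * borelType G => a z.1 z.2).
  apply: measurable_gamma; under eq_fun do rewrite glE.
  have mU : measurable_fun setT
      (fun z : T * borelType G => unit_part z.1 : borelType 'M[R]_n).
    exact: (measurableT_comp measurable_unit_part measurable_fst).
  apply: measurable_mulmx; last exact: measurable_trmx.
  apply: measurable_mulmx => //.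
  have mg : measurable_fun setT ((@gamma_gram R V p p' hpp' :
      borelType G -> borelType 'M[R]_n) \o (snd : T * borelType G -> _)).
    by apply: measurableT_comp => //; exact: measurable_gamma_gram.
  exact: mg.
(* With y = H x, the matrix t sends y where t H sends x. So the set for y is the preimage of the set
   for x under right multiplication by H, a linear map [M] which preserves null sets. *)
have qinv (A : set (borelType G)) (x y : G) : measurable A ->
    phi [set t | A (a t x)] = 0 -> phi [set t | A (a t y)] = 0.
  move=> mA; rewrite !phiE.
  have [H HU HE] := gamma_transitive x y.
  pose M := lin_mx (mulmxr H : 'M[R]_n -> 'M[R]_n).
  have MU : M \in unitmx.
    apply: (proj1 (mulmx1_unit (B := lin_mx (mulmxr (invmx H) : 'M[R]_n -> 'M[R]_n)) _)).
    apply/row_matrixP => i; rewrite !rowE mulmxA mulmx1.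
    by rewrite !mul_rV_lin /= mxvecK mulmxK// vec_mxK.
  have [c c0 cE] := lebesgue_mulmx lamL MU.
  have mS : measurable ([set t | A (a t x)] `&` D).
    apply: measurableI => //.
    have := measurable_fun_pair1 (x : borelType G) ma measurableT mA.
    by rewrite setTI.
  move=> S0; have := cE _ mS; rewrite S0 mule0 => <-; congr (lam _).
  have vM (t : T) : vec_mx ((t : 'rV_(n * n)) *m M) = vec_mx t *m H :> 'M[R]_n.
    by rewrite mul_rV_lin mxvecK.
  have dH : \det H != 0 by move: HU; rewrite unitmxE unitfE.
  have tD (t : T) : D ((t : 'rV_(n * n)) *m M) <-> D t.
    by rewrite /D /= vM det_mulmx mulf_eq0 negb_or dH andbT.
  have aE (t : T) : D t -> a ((t : 'rV_(n * n)) *m M) x = a t y.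
    move=> Dt; apply: gamma_gram_inj; rewrite !glE HE /unit_part.
    rewrite (negbTE Dt) (negbTE (iffRL (tD t) Dt)) vM trmx_mul.
    by rewrite !mulmxA.
  apply/seteqP; split=> t /= [At Dt].
    by split; [rewrite aE|exact/tD].
  have {}Dt := iffLR (tD t) Dt.
  by split=> //; rewrite -aE.
apply: (@invariant_measure_unique R _ _ T (borelType G) phi mu nu a b) => //.
- by rewrite phiE setTI.
- by move=> t; apply: continuous_borel; exact: gbar_continuous.
- move=> t x; apply: gamma_gram_inj; rewrite gl'E glE.
  have uU := unit_part_unit t.
  by rewrite !mulmxA mulVmx// mul1mx -mulmxA -trmx_mul mulVmx// trmx1 mulmx1.
- have [rmu _] := muI.
  exact: (chart_sigma_finite (@gamma_coord_inj _ _ _ _ hpp')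
    (@gamma_open_coord _ _ _ _ hpp') (@gamma_coord_range _ _ _ _ hpp') rmu).
- have [rnu _] := nuI.
  exact: (chart_sigma_finite (@gamma_coord_inj _ _ _ _ hpp')
    (@gamma_open_coord _ _ _ _ hpp') (@gamma_coord_range _ _ _ _ hpp') rnu).
- by move=> t A mA; exact: invariant_measure_setI.
- by move=> t A mA; exact: invariant_measure_setI.
- exact: nonzero_setT.
- exact: nonzero_setT.
Qed.

End gamma_uniqueness.

(** * Existence *)

Section gamma_existence.
Context {R : realType}.

Section congruence.
Context {n : nat}.
Local Notation N := (\dim (@symU R n)).
Implicit Types (P Q : 'M[R]_n).

Definition congr_map P (r : 'rV[R]_N) : 'rV[R]_N :=
  sym_coord (P *m sym_mx r *m P^T).

Lemma congr_map_linear P : linear (congr_map P).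
Proof.
move=> a r s; rewrite /congr_map linearP mulmxDr mulmxDl.
by rewrite -scalemxAr -scalemxAl linearP.
Qed.
HB.instance Definition _ P :=
  GRing.isLinear.Build R _ _ _ (congr_map P) (congr_map_linear P).

Lemma sym_mx_congr P r : sym_mx (congr_map P r) = P *m sym_mx r *m P^T.
Proof. by apply: sym_coordK; rewrite !trmx_mul trmxK sym_mx_sym mulmxA. Qed.

Lemma congr_mapM P Q r : congr_map (P *m Q) r = congr_map P (congr_map Q r).
Proof.
by apply: (can_inj sym_mxK); rewrite !sym_mx_congr trmx_mul !mulmxA.
Qed.

Lemma congr_map_scalar (t : R) r : congr_map t%:M r = t ^+ 2 *: r.
Proof.
apply: (can_inj sym_mxK); rewrite sym_mx_congr tr_scalar_mx linearZ /=.
by rewrite mul_scalar_mx mul_mx_scalar scalerA -expr2.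
Qed.

Lemma congr_mx_unit P : P \in unitmx -> lin1_mx (congr_map P) \in unitmx.
Proof.
move=> PU; apply: (proj1 (mulmx1_unit (B := lin1_mx (congr_map (invmx P))) _)).
apply/row_matrixP => i; rewrite !rowE mulmxA mulmx1 !mul_rV_lin1 /= -congr_mapM.
by rewrite mulVmx// congr_map_scalar expr1n scale1r.
Qed.

Variable lam : {measure set (borelType 'rV[R]_N) -> \bar R}.
Hypothesis lamL : is_lebesgue lam.
Hypothesis n0 : (0 < n)%N.

Definition nroot (d : R) : R := `|d| `^ n%:R^-1.

Lemma nroot_gt0 d : d != 0 -> 0 < nroot d.
Proof. by move=> d0; rewrite powR_gt0// normr_gt0. Qed.

Lemma nrootX d : nroot d ^+ n = `|d|.
Proof.
rewrite -powR_mulrn ?powR_ge0// /nroot -powRrM mulVf ?powRr1//.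
by rewrite pnatr_eq0 -lt0n.
Qed.

(** Write P = t Q with t = |det P|^(1/n). The factor of Q is 1, and that of t is computed from its
    action on symmetric matrices as t^2. *)
Lemma lebesgue_congr P : P \in unitmx ->
  forall A : set (borelType 'rV[R]_N), measurable A ->
  lam [set r | A (congr_map P r)] =
    (((nroot (\det P) ^+ 2) ^- N)%:E * lam A)%E.
Proof.
have /choice[chi chiP] : forall P, exists c : R, P \in unitmx -> 0 < c /\
    forall A : set (borelType 'rV[R]_N), measurable A ->
    lam [set r | A (congr_map P r)] = (c%:E * lam A)%E.
  move=> Q; have [QU|_] := boolP (Q \in unitmx); last by exists 0.
  have [c c0 cE] := lebesgue_mulmx lamL (congr_mx_unit QU).
  exists c => _; split=> // A mA; rewrite -cE//; congr (lam _).
  by apply/seteqP; split=> r /=; rewrite mul_rV_lin1.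
have cube1 : lam (closed_cube 0 1) = ((2 * 1) ^+ N)%:E.
  by have [_ ->] := lamL.
have mcube : measurable (closed_cube 0 1 : set (borelType 'rV[R]_N)).
  exact: measurable_closed_cube.
have two0 : (2 * 1) ^+ N != 0 :> R by rewrite expf_neq0// mulr1 pnatr_eq0.
have mcongr Q (A : set (borelType 'rV[R]_N)) : measurable A ->
    measurable ([set r | A (congr_map Q r)] : set (borelType 'rV[R]_N)).
  move=> mA.
  have := @continuous_borel 'rV[R]_N 'rV[R]_N _
    (@continuous_linear_mx R _ _ _ _ (congr_map Q)).
  by move=> /(_ measurableT _ mA); rewrite setTI.
have chi_gt0 Q : Q \in unitmx -> 0 < chi Q by move=> /chiP[].
have chiE Q (A : set (borelType 'rV[R]_N)) : Q \in unitmx -> measurable A ->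
    lam [set r | A (congr_map Q r)] = ((chi Q)%:E * lam A)%E.
  by move=> /chiP[_]; exact.
have chiM P1 P2 : P1 \in unitmx -> P2 \in unitmx ->
    chi (P1 *m P2) = chi P1 * chi P2.
  move=> U1 U2; have U12 : P1 *m P2 \in unitmx by rewrite unitmx_mul U1.
  have := chiE _ _ U12 mcube.
  under eq_set do rewrite congr_mapM.
  rewrite (chiE P2 _ U2 (mcongr P1 _ mcube)) chiE// cube1 -!EFinM => -[].
  by rewrite mulrA => /(mulIf two0) <-; rewrite mulrC.
have chi_det1 := multiplicative_det1 chi_gt0 chiM.
move=> PU A mA; rewrite chiE//; congr (_%:E * _)%E.
have d0 : \det P != 0 by move: PU; rewrite unitmxE unitfE.
pose t := nroot (\det P); have t0 : 0 < t by exact: nroot_gt0.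
have tU : (t%:M : 'M[R]_n) \in unitmx.
  by rewrite unitmxE det_scalar unitfE expf_neq0// gt_eqF.
pose Q := (t^-1)%:M *m P.
have PE : P = t%:M *m Q.
  by rewrite /Q mulmxA -scalar_mxM divff ?gt_eqF// mul1mx.
(* The determinant of Q may be -1, so [chi_det1] is applied to its square, and positivity gives
   [chi Q = 1]. *)
have dQ : \det Q * \det Q = 1.
  rewrite /Q det_mulmx det_scalar exprVn nrootX mulrACA -invfM -expr2.
  by rewrite -normrX ger0_norm ?sqr_ge0// -expr2 mulVf// sqrf_eq0.
have QU : Q \in unitmx.
  rewrite unitmxE unitfE; apply/eqP => Q0.
  by move/eqP: dQ; rewrite Q0 mul0r eq_sym oner_eq0.
have chiQ : chi Q = 1.
  apply/eqP; rewrite -(@eqrXn2 _ 2)// ?ltW ?chi_gt0// expr1n expr2 -chiM//.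
  by rewrite chi_det1// det_mulmx.
rewrite PE chiM// chiQ mulr1 -PE.
apply: (lebesgue_scale lamL); first by rewrite exprn_gt0.
move=> B mB; rewrite -chiE//; congr (lam _).
by apply/seteqP; split=> r /=; rewrite congr_map_scalar.
Qed.

End congruence.

Section gamma_measure.
Context (V : vectType R) (p p' : nat).
Hypothesis hpp' : (p + p')%N = \dim {:V}.
Hypothesis hn : (0 < \dim {:V})%N.
Local Notation n := (\dim {:V}).
Local Notation G := (Gamma hpp').
Local Notation N := (\dim (@symU R n)).
Local Notation T := (borelType 'rV[R]_N).
Local Notation kappa := (@gamma_coord R V p p' hpp').

(* The value outside the range of kappa is junk; the density below vanishes
   there. *)
Definition gamma_inv (r : 'rV[R]_N) : G := xget point [set x | kappa x = r].

Lemma gamma_invK r : range kappa r -> kappa (gamma_inv r) = r.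
Proof.
by move=> [x _ xr]; rewrite /gamma_inv; case: xgetP => [z -> //|/(_ x)].
Qed.

Lemma measurable_range : measurable (range kappa : set T).
Proof. by apply: borel_open; exact: gamma_coord_range. Qed.

Lemma measurable_gamma_inv :
  measurable_fun setT (gamma_inv : T -> borelType G).
Proof.
apply: (@measurability _ _ T (borelType G) _ _ (@open G) erefl).
move=> _ [_ /gamma_open_coord[W oW ->] <-]; rewrite setTI.
(* Off the range [gamma_inv] is constantly [point], so there the preimage is everything or
   nothing. *)
pose C : set T := if `[< W (kappa point) >] then ~` range kappa else set0.
have -> : gamma_inv @^-1` (kappa @^-1` W) = (range kappa `&` W) `|` C.
  apply/seteqP; split=> r /=.
    have [Er|Er] := pselect (range kappa r).
      by rewrite gamma_invK//; left.
    rewrite /gamma_inv xgetPN => [Wp|x xr]; last by apply: Er; exists x.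
    by right; rewrite /C ifT//; exact/asboolP.
  move=> [[Er Wr]|]; first by rewrite gamma_invK.
  rewrite /C; case: asboolP => // Wp Er.
  by rewrite /gamma_inv xgetPN// => x xr; apply: Er; exists x.
apply: measurableU.
  by apply: measurableI; [exact: measurable_range|exact: borel_open].
by rewrite /C; case: ifP => // _; apply: measurableC; exact: measurable_range.
Qed.

(* This is |det S|^(-N/n), with S = sym_mx r. *)
Definition weight (r : T) : R := nroot (n := n) (\det (sym_mx (r : 'rV[R]_N))) ^- N.
Definition density : T -> \bar R := (EFin \o weight) \_ (range kappa).

Lemma continuous_det_sym : continuous (fun r : 'rV[R]_N => \det (sym_mx r)).
Proof.
move=> r; apply: continuous_comp; last exact: continuous_det.
exact: continuous_linear_mx.
Qed.

Lemma continuous_norm_det_sym :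
  continuous (fun r : 'rV[R]_N => `|\det (sym_mx r)|).
Proof.
move=> r; apply: (@continuous_comp _ _ _ (fun r : 'rV[R]_N => \det (sym_mx r))).
  exact: continuous_det_sym.
exact: norm_continuous.
Qed.

Lemma weightE r : weight r = `|\det (sym_mx (r : 'rV[R]_N))| `^ (- (n%:R^-1 * N%:R)).
Proof. by rewrite /weight powRN powRrM powR_mulrn// powR_ge0. Qed.

Lemma measurable_density : measurable_fun setT density.
Proof.
apply/(measurable_restrictT _ measurable_range)/measurable_funTS.
apply/measurable_EFinP; rewrite (funext weightE).
apply: (measurableT_comp (measurable_powR _)).
by apply: measurableT_comp => //; apply: continuous_borel_real; exact: continuous_det_sym.
Qed.

Lemma weight_ge0 r : 0 <= weight r.
Proof. by rewrite /weight invr_ge0 exprn_ge0// powR_ge0. Qed.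

Lemma density_ge0 r : (0 <= density r)%E.
Proof. by rewrite /density patchE; case: ifP => // _; rewrite lee_fin weight_ge0. Qed.

Lemma gamma_det_neq0 (x : G) : \det (gamma_gram x) != 0.
Proof.
have [g gU gE] := gamma_gram_std x.
have : \det (std_diag V p) != 0 :> R.
  rewrite /std_diag det_diag; apply/prodf_neq0 => i _; rewrite mxE.
  by have [->|->] := @std_signP R V p i; rewrite ?oppr_eq0 oner_eq0.
by rewrite -gE !det_mulmx !mulf_eq0 !negb_or => /andP[/andP[]].
Qed.

Lemma gamma_coord_act (g : GL V) : exists2 P : 'M[R]_n, P \in unitmx &
  forall x : G, kappa (gbar g x) = congr_map P (kappa x).
Proof.
have [P PU PE] := gamma_gram_act hpp' g; exists P => // x.
by rewrite /congr_map gamma_coordK /gamma_coord PE.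
Qed.

Lemma range_congr (P : 'M[R]_n) r : P \in unitmx ->
  range kappa (congr_map P r) <-> range kappa r.
Proof.
have dir (Q : 'M[R]_n) s : Q \in unitmx -> range kappa s -> range kappa (congr_map Q s).
  move=> QU [x _ <-]; have [g gE] := gamma_gram_act_surj hpp' QU.
  by exists (gbar g x) => //; rewrite /congr_map gamma_coordK /gamma_coord gE.
move=> PU; split; last exact: dir.
move=> /(dir (invmx P)); rewrite -congr_mapM mulVmx// congr_map_scalar expr1n scale1r.
by apply; rewrite unitmx_inv.
Qed.

(** The density picks up the very factor of [lebesgue_congr]; this is what fixes its exponent and
    makes the two cancel. *)
Lemma density_congr (P : 'M[R]_n) r : P \in unitmx ->
  density (congr_map P r) =
    (((nroot (n := n) (\det P) ^+ 2) ^- N)%:E * density r)%E.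
Proof.
move=> PU; rewrite /density !patchE.
have -> : (congr_map P r \in range kappa) = (r \in range kappa).
  by apply/idP/idP; rewrite !inE range_congr.
case: ifP => _ /=; last by rewrite mule0.
rewrite -EFinM /weight sym_mx_congr !det_mulmx det_tr mulrAC -expr2.
by rewrite /nroot normrM powRM// normrX expr2 powRM// -expr2 exprMn invfM.
Qed.

Theorem gamma_measure_exists : exists mu : {measure set (borelType G) -> \bar R},
  nonzero_measure mu /\ invariant_measure mu.
Proof.
have [lam lamL] := @lebesgue_exists R N.
have [nu nuE] := density_package lam measurable_density density_ge0.
have [mu muE] := pushforward_package nu measurable_gamma_inv.
have coord_open := @gamma_open_coord _ _ _ _ hpp'.
have coord_range := @gamma_coord_range _ _ _ _ hpp'.
have coord_inj := @gamma_coord_inj _ _ _ _ hpp'.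
have mpre (A : set (borelType G)) : measurable A -> measurable (gamma_inv @^-1` A : set T).
  by move=> mA; have := measurable_gamma_inv measurableT mA; rewrite setTI.
have muI (g : GL V) (A : set (borelType G)) : measurable A -> mu (gbar g @^-1` A) = mu A.
  move=> mA; rewrite !muE !nuE.
  have [P PU PE] := gamma_coord_act g.
  pose k := (nroot (n := n) (\det P) ^+ 2) ^- N.
  have k0 : 0 < k.
    by rewrite invr_gt0 !exprn_gt0// nroot_gt0//; move: PU; rewrite unitmxE unitfE.
  have mL : measurable_fun setT (congr_map P : T -> T).
    apply: continuous_borel.
    exact: (@continuous_linear_mx R _ _ _ _ (congr_map P)).
  (* On the range [gamma_inv] intertwines the two actions, and elsewhere the density is zero. *)
  transitivity (\int[lam]_(r in congr_map P @^-1` (gamma_inv @^-1` A)) density r)%E.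
    rewrite integral_mkcond [RHS]integral_mkcond; apply: eq_integral => r _.
    rewrite !patchE; have [Er|Er] := pselect (range kappa r); last first.
      have -> : density r = 0%E by rewrite /density patchE memNset.
      by rewrite !if_same.
    have -> // : (r \in gamma_inv @^-1` (gbar g @^-1` A)) =
        (r \in congr_map P @^-1` (gamma_inv @^-1` A)).
    have jE : gamma_inv (congr_map P r) = gbar g (gamma_inv r).
      apply: coord_inj; rewrite PE !gamma_invK//.
      exact/(range_congr _ PU).
    by apply/idP/idP; rewrite !inE /= jE.
  pose kn := NngNum (ltW k0).
  transitivity (\int[lam]_(r in congr_map P @^-1` (gamma_inv @^-1` A))
      (k^-1%:E * density (congr_map P r)))%E.
    apply: eq_integral => r _; rewrite density_congr// muleA -EFinM mulVf ?mul1e//.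
    by rewrite gt_eqF.
  rewrite (ge0_integral_comp (m2 := mscale kn lam)
    (f := fun r => (k^-1%:E * density r)%E) mL)//.
  - rewrite ge0_integral_mscale//=.
    + rewrite ge0_integralZl//.
      * by rewrite muleA -EFinM divff ?mul1e// gt_eqF.
      * exact: mpre.
      * exact: (measurable_funTS measurable_density).
      * by move=> r _; exact: density_ge0.
      * by rewrite lee_fin invr_ge0 ltW.
    + exact: mpre.
    + apply: measurable_funeM.
      exact: (measurable_funTS measurable_density).
    + by move=> r _; rewrite mule_ge0// ?density_ge0// lee_fin invr_ge0 ltW.
  - by move=> B mB; rewrite lebesgue_congr.
  - exact: mpre.
  - by apply: measurable_funeM; exact: (measurable_funTS measurable_density).
  - by move=> r; rewrite mule_ge0// ?density_ge0// lee_fin invr_ge0 ltW.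
exists mu; split.
  (* If the total mass were 0, the density would vanish almost everywhere, but it is nonzero on the
     range, a non-empty open set. *)
  exists setT => //; rewrite muE nuE preimage_setT; apply/eqP => mu0.
  have := @lebesgue_open_neq0 R N lam (range kappa) (kappa point) lamL coord_range.
  move=> /(_ _)/negP[]; first by exists point.
  have : ae_eq lam setT density (cst 0%E).
    apply/ae_eq_integral_abs => //; first exact: measurable_density.
    by under eq_integral do rewrite gee0_abs ?density_ge0//.
  move=> [Z [mZ Z0 sZ]]; apply/eqP; apply: (subset_measure0 measurable_range mZ _ Z0).
  move=> _ [x _ <-]; apply: sZ => /= /(_ I) /eqP.
  rewrite /density patchE mem_set /=; last by exists x.
  rewrite eqe /weight gamma_coordK invr_eq0 expf_eq0 gt_eqF ?andbF//.
  exact/nroot_gt0/gamma_det_neq0.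
have reg : regular_measure mu.
  (* The measure can be infinite near infinity or near degenerate forms, so [O k] bounds the
     coordinates and keeps the determinant away from 0. *)
  pose O k := kappa @^-1` (ball (0 : 'rV[R]_N) k.+1%:R `&`
    [set r | k.+1%:R^-1 < `|\det (sym_mx r)|]).
  have oO k : open (O k).
    apply/coord_open; eexists; last reflexivity.
    apply: openI; first exact: ball_open.
    have /continuousP := continuous_norm_det_sym.
    by move=> /(_ [set x | k.+1%:R^-1 < x]); apply; exact: open_gt.
  apply: (@regular_of_open_cover R _ mu (chart_hausdorff coord_inj coord_open)
    (chart_sigma_compact coord_inj coord_open coord_range) O oO).
  - apply/seteqP; split=> // x _.
    have d0 : 0 < `|\det (gamma_gram x)| by rewrite normr_gt0 gamma_det_neq0.
    have /ltr_add_invr[k1] := d0; rewrite add0r => k1d.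
    pose k2 := (Num.truncn `|kappa x|).+1.
    exists (maxn k1 k2) => //; split => /=.
      rewrite mx_norm_ball /ball_ /= sub0r normrN.
      apply: lt_le_trans (truncnS_gt _) _; rewrite ler_nat.
      by apply: leq_trans (leqnSn _); exact: leq_maxr.
    rewrite gamma_coordK; apply: le_lt_trans k1d.
    by rewrite lef_pV2 ?posrE// ler_nat ltnS leq_maxl.
  - move=> k; rewrite muE nuE integral_mkcond.
    (* The exponent of |det S| in the weight is at most 0, so the lower bound on |det S| in [O k]
       bounds the weight by [M]. *)
    pose M : R := (k.+1%:R^-1 `^ (n%:R^-1 * N%:R))^-1.
    pose Q : set T := closed_cube 0 k.+1%:R.
    have mQ : measurable Q by exact: measurable_closed_cube.
    have mO : measurable (gamma_inv @^-1` O k : set T).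
      by apply: mpre; exact: borel_open.
    apply: (@le_lt_trans _ _ (\int[lam]_r ((cst M%:E) \_ Q) r)%E).
      apply: ge0_le_integral => //.
      + by move=> r _; apply: erestrict_ge0 => s _; exact: density_ge0.
      + apply/(measurable_restrictT _ mO).
        exact: (measurable_funTS measurable_density).
      + by apply/(measurable_restrictT _ mQ); exact: measurable_cst.
      move=> r _; rewrite !patchE.
      have [Er|Er] := pselect (range kappa r); last first.
        have -> : density r = 0%E by rewrite /density patchE memNset.
        rewrite if_same; case: ifP => // _.
        by rewrite /= lee_fin invr_ge0 powR_ge0.
      case: ifPn => [|_]; last first.
        by case: ifP => // _; rewrite /= lee_fin invr_ge0 powR_ge0.
      rewrite inE /O /= gamma_invK// => -[rk dk].
      rewrite mem_set; last exact: ball_closed_cube.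
      rewrite /density patchE mem_set //= lee_fin weightE powRN.
      rewrite lef_pV2 ?posrE ?powR_gt0//; last exact: lt_trans dk.
      by apply: ge0_ler_powR; rewrite ?nnegrE ?mulr_ge0// ltW.
    rewrite -integral_mkcond integral_cst//.
    have [_ lc] := lamL; rewrite lc// -EFinM.
    exact: ltry.
split=> // g; split=> // f cf _.
apply/esym/(@integral_comp R _ _ (borelType G) (borelType G) mu mu (gbar g) (EFin \o f)).
- by apply: continuous_borel; exact: gbar_continuous.
- by move=> A mA; exact: muI.
- by apply/measurable_EFinP; exact: continuous_borel_real.
Qed.

End gamma_measure.
End gamma_existence.

Theorem proposition3p2 (R : realType) (V : vectType R) (p p' : nat)
    (hn : (0 < \dim {:V})%N) (hpp' : (p + p')%N = \dim {:V}) :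
  (exists mu : {measure set (borelType (Gamma hpp')) -> \bar R},
     nonzero_measure mu /\ invariant_measure mu) /\
  (forall mu mu' : {measure set (borelType (Gamma hpp')) -> \bar R},
     nonzero_measure mu -> invariant_measure mu ->
     nonzero_measure mu' -> invariant_measure mu' ->
     exists2 c : R, 0 < c &
       forall A : set (borelType (Gamma hpp')), measurable A ->
         mu A = (c%:E * mu' A)%E).
Proof.
split; first exact: gamma_measure_exists.
by move=> mu mu' mu0 muI mu'0 mu'I; exact: gamma_measure_unique.
Qed.
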